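(* Let $\lambda>0$, $d\in\mathbb{N}$, let $f_{in},f_{out}$ satisfy $1\ge f_{in}(r)\ge f_{out}(r)\ge 0$ for all $r\ge 0$ and $0<\int_{\mathbb{R}^d}(f_{in}(\|x\|)+f_{out}(\|x\|))dx<\infty$, and suppose $\{r\ge0: f_{in}(r)\ne f_{out}(r)\}$ has positive Lebesgue measure. Then for every $g:\mathbb{R}_+\to[0,1]$, the probability measures induced on the space of spatial graphs $\mathbb{M}_{\mathcal{G}}(\mathbb{R}^d)$ by $G$ and by $H_{\lambda,g(\cdot),d}$ are mutually singular.
   Context: All functions are measurable and $\|\cdot\|$ is the Euclidean norm. $\mathbb{M}_{\mathcal{G}}(\mathbb{R}^d)$ is the Polish space (with its Borel $\sigma$-algebra) of all simple spatial graphs whose vertex set is a locally finite subset of $\mathbb{R}^d$; an element records the vertex locations and the edges (not community labels). Planted partition graph $G$: let $\phi=\{X_1,X_2,\dots\}$ be a homogeneous Poisson point process of intensity $\lambda$ on $\mathbb{R}^d$; independently let $(Z_i)_{i\in\mathbb{N}}$ be i.i.d. uniform on $\{-1,+1\}$. Conditionally on locations and labels, each pair $i\neq j$ is joined by an edge independently with probability $f_{in}(\|X_i-X_j\|)$ if $Z_i=Z_j$ and $f_{out}(\|X_i-X_j\|)$ if $Z_i\ne Z_j$. $G$ is viewed as a random spatial graph with vertex set $\phi$. Random connection model $H_{\lambda,g(\cdot),d}$: the random spatial graph whose vertices form a homogeneous Poisson point process of intensity $\lambda$ on $\mathbb{R}^d$ and where, conditionally on the locations, two points $x,y$ are joined independently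 with probability $g(\|x-y\|)$. *)

(* Defs.v *)
From HB Require Import structures.
From mathcomp Require Import all_boot all_order all_algebra finmap.
From mathcomp Require Import all_classical all_reals all_analysis.
Set Implicit Arguments.
Unset Strict Implicit.
Unset Printing Implicit Defensive.
Import Order.TTheory GRing.Theory Num.Theory.
Import numFieldNormedType.Exports.
Local Open Scope classical_set_scope.
Local Open Scope ring_scope.

(* The library's norm on matrices is the sup norm. *)
Definition enorm (R : realType) (d : nat) (x : 'rV[R]_d) : R :=
  Num.sqrt (\sum_(i < d) x ord0 i ^+ 2).

(* R^d carries the sigma-algebra generated by the coordinates (as the library
   does for tuples), i.e. the Borel sigma-algebra. *)
Definition rowvec_display : measure_display.
Proof. exact: (measure_tuple_display default_measure_display). Qed.

Section measurable_rowvec.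
Context {R : realType}.
Variable d : nat.

Let coords : 'I_d -> 'rV[R]_d -> R := fun i x => x ord0 i.

Let rowvec_set0 : g_sigma_preimage coords set0.
Proof. exact: sigma_algebra0. Qed.

Let rowvec_setC A : g_sigma_preimage coords A -> g_sigma_preimage coords (~` A).
Proof. exact: sigma_algebraC. Qed.

Let rowvec_bigcup (F : (set _)^nat) : (forall i, g_sigma_preimage coords (F i)) ->
  g_sigma_preimage coords (\bigcup_i (F i)).
Proof. exact: sigma_algebra_bigcup. Qed.

HB.instance Definition _ := @isMeasurable.Build rowvec_display
  'rV[R]_d (g_sigma_preimage coords) rowvec_set0 rowvec_setC rowvec_bigcup.

End measurable_rowvec.

Lemma measurable_coord (R : realType) (d : nat) (i : 'I_d) :
  measurable_fun [set: 'rV[R]_d] (fun x : 'rV[R]_d => x ord0 i).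
Proof.
move=> _ Y mY; rewrite setTI; apply: sub_sigma_algebra => /=.
rewrite -bigcup_seq/=; exists i => /=; first by rewrite mem_index_enum.
by exists Y => //; rewrite setTI.
Qed.

Lemma measurable_fun_rowvecP (R : realType) (d : nat) (dT : measure_display)
    (T : measurableType dT) (f : T -> 'rV[R]_d) :
  (forall i, measurable_fun [set: T] (fun x => f x ord0 i)) ->
  measurable_fun [set: T] f.
Proof.
move=> mf _ A mA; rewrite setTI.
suff: g_sigma_preimage (fun (i : 'I_d) (x : 'rV[R]_d) => x ord0 i) `<=`
      [set A | measurable (f @^-1` A)] by apply.
apply: smallest_sub.
  split => /=; first by rewrite preimage_set0.
    by move=> B mB; rewrite setTD preimage_setC; exact: measurableC.
  by move=> F mF; rewrite preimage_bigcup; exact: bigcup_measurable.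
rewrite -bigcup_seq; apply: bigcup_sub => i _ _ [B mB <-] /=.
by rewrite setTI -[X in measurable X]setTI; exact: mf.
Qed.

Definition rowvec_cons (R : realType) (d : nat) (p : R * 'rV[R]_d) : 'rV[R]_d.+1 :=
  \row_(i < d.+1) oapp (fun j => p.2 ord0 j) p.1 (unlift ord0 i).

Lemma measurable_rowvec_cons (R : realType) (d : nat) :
  measurable_fun [set: R * 'rV[R]_d] (@rowvec_cons R d).
Proof.
apply: measurable_fun_rowvecP => i.
rewrite (_ : (fun _ => _) = fun p : R * 'rV[R]_d =>
    oapp (fun j => p.2 ord0 j) p.1 (unlift ord0 i)); last first.
  by apply/funext => p; rewrite mxE.
case: (unlift ord0 i) => [j|] /=; last exact: measurable_fst.
exact: (measurableT_comp (@measurable_coord R d j) measurable_snd).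
Qed.

(* Lebesgue measure on R^d, as the d-fold product of Lebesgue measure on R;
   the constant applied below bundles [pushforward] as a measure. *)
Fixpoint vol (R : realType) (d : nat) : {measure set 'rV[R]_d -> \bar R} :=
  match d with
  | 0%N => dirac (0 : 'rV[R]_0)
  | e.+1 => measure_function_pushforward__canonical__measure_function_Measure
              ((@lebesgue_measure R) \x^ (vol R e))%E (@measurable_rowvec_cons R e)
  end.

Record spatial_graph (R : realType) (d : nat) := SpatialGraph {
  vertices : set 'rV[R]_d;
  edges : set ('rV[R]_d * 'rV[R]_d);
  vertices_locally_finite : forall K : set 'rV[R]_d,
    compact K -> finite_set (vertices `&` K);
  edges_vertices : edges `<=` vertices `*` vertices;
  edges_sym : forall x y, edges (x, y) -> edges (y, x);
  edges_irrefl : forall x, ~ edges (x, x) }.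

Definition empty_graph (R : realType) (d : nat) : spatial_graph R d.
Proof.
apply: (@SpatialGraph R d set0 set0) => [K _||x y|x] //.
by rewrite set0I; exact: finite_set0.
Defined.

HB.instance Definition _ (R : realType) (d : nat) :=
  gen_eqMixin (spatial_graph R d).
HB.instance Definition _ (R : realType) (d : nat) :=
  gen_choiceMixin (spatial_graph R d).
HB.instance Definition _ (R : realType) (d : nat) :=
  isPointed.Build (spatial_graph R d) (@empty_graph R d).

Definition cont_compact_support (R : realType) (T : topologicalType)
    (f : T -> R) : Prop :=
  continuous f /\ compact (closure [set x | f x != 0]).

(* The topology on spatial graphs is the vague topology for the pair formed by
   the counting measure of the vertices (on R^d) and the counting measure of
   the ordered edges (on R^d x R^d): the coarsest one making the integrals of
   continuous compactly supported functions against both measures continuous.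
   These integrals are sums with finitely many nonzero terms, by local
   finiteness. *)
Definition vague_subbase (R : realType) (d : nat) :
    set (set (spatial_graph R d)) :=
  [set A | exists (f : 'rV[R]_d -> R) (U : set R),
     [/\ cont_compact_support f, open U &
         A = [set G | U (\sum_(x \in vertices G) f x)]]] `|`
  [set A | exists (h : 'rV[R]_d * 'rV[R]_d -> R) (U : set R),
     [/\ cont_compact_support h, open U &
         A = [set G | U (\sum_(e \in edges G) h e)]]].

HB.instance Definition _ (R : realType) (d : nat) :=
  isSubBaseTopological.Build (spatial_graph R d) (@vague_subbase R d) id.

Definition spatial_graph_display : measure_display.
Proof. exact: default_measure_display. Qed.

HB.instance Definition _ (R : realType) (d : nat) :=
  @isMeasurable.Build spatial_graph_display (spatial_graph R d)
    <<s @open (spatial_graph R d) >>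
    (@sigma_algebra0 _ setT _) (@sigma_algebraC _ _)
    (@sigma_algebra_bigcup _ setT _).

Definition mutually_singular (R : realType) (dT : measure_display)
    (T : measurableType dT) (mu nu : {measure set T -> \bar R}) : Prop :=
  exists A : set T, [/\ measurable A, mu A = 0%E & nu (~` A) = 0%E].

Section probability_notions.
Context (R : realType) (dO : measure_display) (Omega : measurableType dO).
Variable P : probability Omega R.

Definition sigma_of (dT : measure_display) (T : measurableType dT)
    (X : nat -> Omega -> T) : set (set Omega) :=
  <<s \bigcup_i g_sigma_algebra_preimage (X i) >>.

Definition mutually_independent (I : choiceType) (F : I -> set (set Omega)) :
    Prop :=
  forall (J : {fset I}) (E : I -> set Omega), (forall i, i \in J -> F i (E i)) ->
    P (\bigcap_(i in [set` J]) E i) = (\prod_(i <- J) P (E i))%E.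

(* Conditionally on the sigma-algebra F, the events (A i), i in D, are
   independent with conditional probabilities (p i): the conditional
   probability of every finite pattern e of occurrences is the corresponding
   product, in the sense of integrals over all B in F. *)
Definition cond_independent_events (F : set (set Omega)) (I : choiceType)
    (D : set I) (A : I -> set Omega) (p : I -> Omega -> R) : Prop :=
  (forall i, D i -> measurable (A i)) /\
  forall (J : {fset I}) (e : I -> bool) (B : set Omega),
    [set` J] `<=` D -> F B ->
    P (B `&` \bigcap_(i in [set` J]) (if e i then A i else ~` A i)) =
    (\int[P]_(w in B)
       (\prod_(i <- J) (if e i then p i w else 1 - p i w))%:E)%E.

(* The library's [poisson_pmf] is 1 for every k at rate 0, whereas B of volume
   zero must have k = 0 points almost surely; hence the explicit formula. *)
Definition homogeneous_poisson (d : nat) (lambda : R)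
    (Phi : Omega -> set 'rV[R]_d) : Prop :=
  forall (n : nat) (B : 'I_n -> set 'rV[R]_d) (k : 'I_n -> nat),
    (forall i, measurable (B i) /\ (vol R d (B i) < +oo)%E) ->
    trivIset [set: 'I_n] B ->
    P (\bigcap_(i in [set: 'I_n])
         [set w | counting (Phi w `&` B i) = (k i)%:R%:E :> \bar R]) =
    (\prod_(i < n)
       let m := lambda * fine (vol R d (B i)) in
       expR (- m) * m ^+ k i / (k i)`!%:R)%:E.

Definition uniform_sign (Z : Omega -> R) : Prop :=
  P [set w | Z w = 1] = (2^-1)%:E /\ P [set w | Z w = -1] = (2^-1)%:E.

Section random_graphs.
Variables (d : nat) (lambda : R).
Variable G : {mfun Omega >-> spatial_graph R d}.

Definition enumerates_vertices (X : nat -> Omega -> 'rV[R]_d) : Prop :=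
  {ae P, forall w, injective (fun i => X i w) /\
                   vertices (G w) = range (fun i => X i w)}.

Definition edge_event (X : nat -> Omega -> 'rV[R]_d) (ij : nat * nat) :
    set Omega :=
  [set w | edges (G w) (X ij.1 w, X ij.2 w)].

(* Unordered pairs of distinct indices are represented by i < j. *)
Definition index_pairs : set (nat * nat) := [set ij | (ij.1 < ij.2)%N].

Definition planted_partition_graph (fin fout : R -> R) : Prop :=
  exists (X : nat -> {mfun Omega >-> 'rV[R]_d}) (Z : nat -> {mfun Omega >-> R}),
  [/\ homogeneous_poisson lambda (fun w => vertices (G w)) /\
        enumerates_vertices X,
      forall i, uniform_sign (Z i),
      mutually_independent (fun o : option nat =>
        if o is Some i then g_sigma_algebra_preimage (Z i) else sigma_of X) &
      cond_independent_events (<<s sigma_of X `|` sigma_of Z >>) index_pairs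
        (edge_event X)
        (fun ij w =>
           let r := enorm (X ij.1 w - X ij.2 w) in
           if Z ij.1 w == Z ij.2 w then fin r else fout r)].

Definition random_connection_model (g : R -> R) : Prop :=
  exists X : nat -> {mfun Omega >-> 'rV[R]_d},
  [/\ homogeneous_poisson lambda (fun w => vertices (G w)),
      enumerates_vertices X &
      cond_independent_events (sigma_of X) index_pairs (edge_event X)
        (fun ij w => g (enorm (X ij.1 w - X ij.2 w)))].

End random_graphs.
End probability_notions.

(* Main.v *)
Require Import Defs.
From HB Require Import structures.
From mathcomp Require Import all_boot all_order all_algebra finmap.
From mathcomp Require Import all_classical all_reals all_analysis.
From mathcomp Require Import measurable_realfun.
From mathcomp Require Import ring lra.
Import Order.TTheory GRing.Theory Num.Theory.
Import numFieldNormedType.Exports.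
Local Open Scope classical_set_scope.
Local Open Scope ring_scope.
Set Implicit Arguments.
Unset Strict Implicit.
Unset Printing Implicit Defensive.

(** Both models have the same Poisson vertices, so they are told apart by small
patterns of edges that recur independently in far apart places.

Take four pairwise disjoint boxes and suppose that each holds exactly one vertex. The
locations of these vertices then have the same law in both models: independent
uniform points ([cell_lawP]). Given the locations, the edges of a pattern E are all
present with probability the product of the values of g along E in the random
connection model ([rcm_edge_law]), and with the average of such products over the
hidden signs in the planted model ([planted_edge_law]). Let m and h be the half-sum
and the half-difference of the two connection functions of the planted model. For
equal signs the connection probability is m + h and for opposite signs m - h, so a
single edge averages to m; around the 4-cycle K_{2,2} every sign occurs twice and the
average is prod m + prod h. Where h is positive on the four edges, a function g that
matches the single edges equals m on them and misses the 4-cycle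
([test_patterns_separate]).

Such configurations are not null. The vectors z with h(|z|) > 0 have positive volume,
because the norm is a Lipschitz function of the first coordinate
([volume_radial_gt0]). The measure of the 4-cycles built from such vectors is the
integral of a squared codegree, which is positive by Tonelli's theorem
([four_cycle_neq0]), and countably many quadruples of disjoint rational boxes cover
almost all of them ([four_cycle_in_boxes]). Hence for some pattern E and some set C of
configurations in four disjoint boxes, the event that the boxes hold one vertex each,
located in C and joined along E, has different probabilities in the two models.

Translates of this event along the first axis all have the same probability and are
pairwise independent, in each model ([shifted_pattern_frequency],
[shifted_pattern_pair_frequency]). Their frequencies converge to different limits, and
Chebyshev's inequality with the Borel-Cantelli lemma gives a set of graphs that is
null for one model and conull for the other ([singular_of_frequencies]).

Two points need care. The vague topology controls only sums of continuous functions
over vertices and edges, from which counts of vertices and the presence of edges must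
be recovered as measurable functionals ([measurable_count], [measurable_linked]). And
the vertices come with an arbitrary measurable enumeration, so that the vertex in a
given box has a random index ([edge_formula]). *)

(** * Lebesgue measure on R^d *)

(** Covering the source by intervals of small total length covers the image by
intervals at most twice as long. *)
Lemma lipschitz_null_image (R : realType) (f : R -> R) (A B : set R) :
  (forall x y, `|f x - f y| <= `|x - y|) ->
  B `<=` f @` A -> measurable B -> lebesgue_measure A = 0%E ->
  lebesgue_measure B = 0%E.
Proof.
move=> flip BfA mB A0; apply/eqP; rewrite eq_le measure_ge0 andbT.
apply/lee_addgt0Pr => e e0; rewrite add0e.
have /ereal_inf_lt[z [/= M covM sMz ze]] : (lebesgue_measure A < (e / 2)%:E)%E.
  by rewrite A0 lte_fin divr_gt0.
have [mM AM] := covM.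
have /choice[N hN] n : exists N : set R, [/\ measurable N, f @` M n `<=` N &
    (lebesgue_measure N <= 2%:E * lebesgue_measure (M n))%E].
  have /ocitvP[->|[[a b /= ab ->]]] : ocitv (M n) := mM n.
    by exists set0; split; rewrite ?image_set0 ?measure0 ?mule0.
  exists `[f b - (b - a), f b + (b - a)]%classic; split.
  - exact: measurable_itv.
  - move=> _ [x /= xab <-]; move: xab; rewrite !in_itv/= => /andP[ax xb].
    have := flip x b; rewrite ler_norml.
    have -> : `|x - b| = b - x by rewrite distrC ger0_norm ?subr_ge0.
    by move=> /andP[h1 h2]; apply/andP; split; lra.
  - rewrite !lebesgue_measure_itv/= !lte_fin ab.
    have -> : f b - (b - a) < f b + (b - a) by lra.
    by rewrite -!EFinB -EFinM lee_fin; lra.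
apply: (@le_trans _ _ (lebesgue_measure (\bigcup_n N n))).
  apply: le_measure; rewrite ?inE//.
    by apply: bigcupT_measurable => n; have [] := hN n.
  move=> y /BfA[x Ax <-]; have [n _ Mx] := AM _ Ax.
  by exists n => //; have [_ + _] := hN n; apply; exists x.
apply: (@le_trans _ _ (\sum_(n <oo) lebesgue_measure (N n))%E).
  by apply: outer_measure_sigma_subadditive.
apply: (@le_trans _ _ (\sum_(n <oo) (2%:E * lebesgue_measure (M n)))%E).
  by apply: lee_nneseries => // n _; have [] := hN n.
rewrite nneseriesZl//.
have -> : (e%:E = 2%:E * (e / 2)%:E)%E by rewrite -EFinM; congr EFin; lra.
apply: lee_pmul => //; first by apply: nneseries_ge0.
apply: le_trans (ltW ze); rewrite -sMz; apply: lee_nneseries => // n _.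
have /ocitvP[->|[[a b /= ab ->]]] := mM n; first by rewrite measure0.
by rewrite wlength_itv lebesgue_measure_itv.
Qed.

Definition box (R : realType) (d : nat) (a b : 'rV[R]_d) : set 'rV[R]_d :=
  [set x | forall i, a ord0 i < x ord0 i < b ord0 i].

Lemma measurable_box (R : realType) (d : nat) (a b : 'rV[R]_d) :
  measurable (box a b).
Proof.
have -> : box a b = \bigcap_(i in [set: 'I_d])
    ((fun x => x ord0 i) @^-1` `]a ord0 i, b ord0 i[%classic).
  apply/seteqP; split => x /=.
    by move=> h i _ /=; rewrite in_itv/=.
  by move=> h i; have := h i I; rewrite /= in_itv.
apply: fin_bigcap_measurable => // i _.
by rewrite -[X in measurable X]setTI; exact: measurable_coord.
Qed.

(** The measure [vol] as a plain function, to which sigma-finiteness can be attached. *)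
Definition volume (R : realType) (d : nat) : set 'rV[R]_d -> \bar R := vol R d.
HB.instance Definition _ R d := Measure.on (@volume R d).

Lemma volume_box (R : realType) (d : nat) (a b : 'rV[R]_d) :
  (forall i, a ord0 i <= b ord0 i) ->
  volume (box a b) = (\prod_(i < d) (b ord0 i - a ord0 i))%:E.
Proof.
rewrite /volume.
elim: d a b => [|d IH] a b ab.
  rewrite big_ord0 /= diracE mem_set//= => -[]//.
pose t (x : 'rV[R]_d.+1) : 'rV[R]_d := \row_j x ord0 (lift ord0 j).
rewrite /= /pushforward.
rewrite (_ : _ @^-1` _ = `]a ord0 ord0, b ord0 ord0[%classic `*` box (t a) (t b)); last first.
  apply/seteqP; split=> -[x y] /=.
    move=> h; split; first by have := h ord0; rewrite mxE unlift_none /= in_itv.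
    by move=> i; have := h (lift ord0 i); rewrite !mxE liftK.
  move=> [hx hy] i; rewrite mxE; case: unliftP => [j ->|->]/=; last first.
    by move: hx; rewrite /= in_itv.
  by have := hy j; rewrite !mxE.
rewrite product_measure2E//; [|exact: measurable_box].
rewrite IH; last by move=> i; rewrite !mxE.
rewrite big_ord_recl EFinM.
congr (_ * _)%E.
  rewrite -[LHS]/(lebesgue_measure `]a ord0 ord0, b ord0 ord0[%classic).
  rewrite lebesgue_measure_itv/= lte_fin.
  by case: ltgtP (ab ord0) => // -> _; rewrite subrr.
by congr EFin; apply: eq_bigr => i _; rewrite !mxE.
Qed.

Lemma volume_box_lty (R : realType) (d : nat) (a b : 'rV[R]_d) :
  (volume (box a b) < +oo)%E.
Proof.
have [ab|ab] := pselect (forall i, a ord0 i <= b ord0 i).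
  by rewrite volume_box// ltry.
suff -> : box a b = set0 by rewrite measure0.
apply/seteqP; split => // x h; apply: ab => i.
by have /andP[h1 h2] := h i; exact/ltW/(lt_trans h1).
Qed.

Lemma lt_bound_sumnorm (R : realType) (d : nat) (x : 'rV[R]_d) i :
  `|x ord0 i| < (Num.bound (\sum_j `|x ord0 j|))%:R.
Proof.
apply: (@le_lt_trans _ _ (\sum_j `|x ord0 j|)).
  by rewrite (bigD1 i)//= lerDl sumr_ge0.
by apply: archi_boundP; exact: sumr_ge0.
Qed.

Lemma bigcup_boxes (R : realType) (d : nat) :
  \bigcup_n box (const_mx (- n%:R)) (const_mx n%:R) = [set: 'rV[R]_d].
Proof.
rewrite -subTset => x _; exists (Num.bound (\sum_j `|x ord0 j|)) => // i.
by rewrite !mxE -ltr_norml; exact: lt_bound_sumnorm.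
Qed.

Lemma volume_sigma_finite (R : realType) (d : nat) :
  sigma_finite [set: 'rV[R]_d] (@volume R d).
Proof.
exists (fun n => box (const_mx (- n%:R)) (const_mx n%:R)).
  exact/esym/bigcup_boxes.
by move=> n; split; [exact: measurable_box|exact: volume_box_lty].
Qed.
HB.instance Definition _ R d :=
  @Measure_isSigmaFinite.Build _ _ _ (@volume R d) (@volume_sigma_finite R d).

Lemma measurable_rowvec_boxes (R : realType) (d : nat) :
  @measurable _ 'rV[R]_d = <<s [set B | exists a b, B = box a b] >>.
Proof.
apply/seteqP; split; last first.
  apply: smallest_sub; first exact: sigma_algebra_measurable.
  by move=> _ [a [b ->]]; exact: measurable_box.
set S := <<s _ >>.
have sS : sigma_algebra setT S by exact: smallest_sigma_algebra.
apply: smallest_sub => //; rewrite -bigcup_seq; apply: bigcup_sub => i _ _ [Y mY <-].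
rewrite setTI; have mE : @measurable _ R = <<s @RGenOInfty.G R >> := RGenOInfty.measurableE R.
move: Y mY; rewrite mE.
apply: smallest_sub.
  split => /=.
  - by rewrite preimage_set0; exact: sigma_algebra0.
  - by move=> B SB; rewrite setTD preimage_setC; exact: sigma_algebraC.
  - by move=> F SF; rewrite preimage_bigcup; exact: sigma_algebra_bigcup.
move=> _ [c ->] /=.
pose a n : 'rV[R]_d := \row_j (if j == i then c else - n%:R).
have -> : (fun x : 'rV[R]_d => x ord0 i) @^-1` `]c, +oo[ =
    \bigcup_n box (a n) (const_mx n%:R).
  apply/seteqP; split => x /=; last first.
    by move=> [n _ /(_ i)]; rewrite !mxE eqxx => /andP[cx _]; rewrite in_itv/= cx.
  rewrite in_itv/= andbT => cx.
  exists (Num.bound (\sum_j `|x ord0 j|)) => // j; rewrite !mxE.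
  by have := lt_bound_sumnorm x j; rewrite ltr_norml; case: eqP => [->|_//]; rewrite cx => /andP[].
apply: sigma_algebra_bigcup => n; apply: sub_sigma_algebra.
by exists (a n), (const_mx n%:R).
Qed.

Lemma setI_closed_boxes (R : realType) (d : nat) :
  setI_closed [set B : set 'rV[R]_d | exists a b, B = box a b].
Proof.
move=> _ _ [a1 [b1 ->]] [a2 [b2 ->]].
exists (\row_i Num.max (a1 ord0 i) (a2 ord0 i)),
       (\row_i Num.min (b1 ord0 i) (b2 ord0 i)).
apply/seteqP; split => x /=.
  move=> [h1 h2] i; rewrite !mxE gt_max lt_min.
  by have /andP[-> ->] := h1 i; have /andP[-> ->] := h2 i.
move=> h; split => i; have := h i; rewrite !mxE gt_max lt_min;
  by move=> /andP[/andP[? ?] /andP[? ?]]; apply/andP.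
Qed.

Lemma preimage_translate_box (R : realType) (d : nat) (v a b : 'rV[R]_d) :
  (fun x => x + v) @^-1` box a b = box (a - v) (b - v).
Proof.
by apply/seteqP; split => x /= h i; have := h i; rewrite !mxE ltrBlDr ltrBrDr.
Qed.

Lemma measurable_translate (R : realType) (d : nat) (v : 'rV[R]_d) :
  measurable_fun [set: 'rV[R]_d] (fun x => x + v).
Proof.
apply: measurable_fun_rowvecP => i.
under eq_fun do rewrite mxE.
by apply: measurable_funD; [exact: measurable_coord|exact: measurable_cst].
Qed.

Lemma volume_translate (R : realType) (d : nat) (v : 'rV[R]_d) A :
  measurable A -> volume ((fun x => x + v) @^-1` A) = volume A.
Proof.
move=> mA; apply/esym.
pose mu := measure_function_pushforward__canonical__measure_function_Measure
  (@volume R d) (@measurable_translate R d v).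
apply: (measure_unique [set B | exists a b, B = box a b]
  (fun n => box (const_mx (- n%:R)) (const_mx n%:R)) _ _ _ _ _ mu) => //.
- exact: measurable_rowvec_boxes.
- exact: setI_closed_boxes.
- by move=> n; do 2 eexists.
- exact: bigcup_boxes.
- move=> _ [a [b ->]]; rewrite /mu /= /pushforward preimage_translate_box.
  have [ab|ab] := pselect (forall i, a ord0 i <= b ord0 i).
    rewrite !volume_box//; last by move=> i; rewrite !mxE lerD2r.
    by congr EFin; apply: eq_bigr => i _; rewrite !mxE; lra.
  have E w : box (a - w) (b - w) = set0.
    apply/seteqP; split => // x h; apply: ab => i.
    by have := h i; rewrite !mxE => /andP[h1 /(lt_trans h1)]; rewrite ltrD2r => /ltW.
  by rewrite E -(subr0 a) -(subr0 b) E.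
- by move=> n; exact: volume_box_lty.
Qed.

Lemma measurable_rowvec1 (R : realType) (d : nat) (x : 'rV[R]_d) :
  measurable [set x].
Proof.
have -> : [set x] = \bigcap_(i in [set: 'I_d]) ((fun y => y ord0 i) @^-1` [set x ord0 i]).
  apply/seteqP; split => y /= => [-> //|h]; apply/rowP => i; exact: h.
apply: fin_bigcap_measurable => // i _.
by rewrite -[X in measurable X]setTI; apply: measurable_coord => //; exact: measurable_set1.
Qed.

Lemma volume1 (R : realType) (d : nat) (x : 'rV[R]_d.+1) : volume [set x] = 0%E.
Proof.
rewrite /volume /= /pushforward.
pose y : 'rV[R]_d := \row_j x ord0 (lift ord0 j).
rewrite (_ : _ @^-1` _ = [set x ord0 ord0] `*` [set y]); last first.
  apply/seteqP; split => -[t z] /=.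
    move=> h; split; first by rewrite -h mxE unlift_none.
    by apply/rowP => j; rewrite /y mxE -h mxE liftK.
  move=> [-> ->]; apply/rowP => j; rewrite mxE /=.
  by case: unliftP => [k ->|->] //=; rewrite mxE.
rewrite product_measure2E//; last exact: measurable_rowvec1.
by rewrite [X in (X * _)%E]lebesgue_measure_set1 mul0e.
Qed.

Lemma measurable_sumsq (R : realType) (d : nat) :
  measurable_fun [set: 'rV[R]_d] (fun x : 'rV[R]_d => \sum_i x ord0 i ^+ 2).
Proof.
by apply: measurable_sum => i; apply: measurable_funX; exact: measurable_coord.
Qed.

Lemma measurable_enorm (R : realType) (d : nat) :
  measurable_fun [set: 'rV[R]_d] (@enorm R d).
Proof.
rewrite (_ : @enorm R d = Num.sqrt \o (fun x : 'rV[R]_d => \sum_i x ord0 i ^+ 2))//.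
apply: measurableT_comp.
  by apply: continuous_measurable_fun; exact: sqrt_continuous.
exact: measurable_sumsq.
Qed.

Lemma enorm_ge0 (R : realType) (d : nat) (x : 'rV[R]_d) : 0 <= enorm x.
Proof. exact: sqrtr_ge0. Qed.

Lemma enorm_subC (R : realType) (d : nat) (x y : 'rV[R]_d) : enorm (x - y) = enorm (y - x).
Proof.
by rewrite /enorm; congr Num.sqrt; apply: eq_bigr => i _; rewrite !mxE -sqrrN opprB.
Qed.

Lemma measure0_of_integral0 d (T : measurableType d) (R : realType)
    (mu : {measure set T -> \bar R}) (D : set T) (f : T -> \bar R) :
  measurable D -> measurable_fun D f -> (forall x, D x -> (0 <= f x)%E) ->
  (\int[mu]_(x in D) f x = 0)%E -> mu (D `&` [set x | (0 < f x)%E]) = 0%E.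
Proof.
move=> mD mf f0 i0.
have mS : measurable (D `&` [set x | (0 < f x)%E]).
  have -> : [set x | (0 < f x)%E] = f @^-1` `]0%E, +oo[%classic.
    by apply/seteqP; split => x /=; rewrite in_itv/= andbT.
  by apply: mf => //; exact: emeasurable_itv.
have : (\int[mu]_(x in D) `|f x| = 0)%E.
  by rewrite -i0; apply: eq_integral => x /[!inE] Dx; rewrite gee0_abs// f0.
move/(ae_eq_integral_abs _ mD mf) => -[N [mN N0 sN]].
apply/eqP; rewrite eq_le measure_ge0 andbT -[leRHS]N0.
apply: le_measure; rewrite ?inE//.
by move=> x [Dx /= fx]; apply: sN => /= /(_ Dx) fx0; move: fx; rewrite fx0 ltxx.
Qed.

Lemma sqrt_sumsq_lipschitz (R : realType) (s x y : R) : 0 <= s ->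
  `|Num.sqrt (x ^+ 2 + s) - Num.sqrt (y ^+ 2 + s)| <= `|x - y|.
Proof.
move=> s0.
suff h u w : Num.sqrt (u ^+ 2 + s) - Num.sqrt (w ^+ 2 + s) <= `|u - w|.
  by rewrite ler_norml h andbT lerNl opprB distrC h.
set q := Num.sqrt (w ^+ 2 + s).
have q0 : 0 <= q by exact: sqrtr_ge0.
have qE : q ^+ 2 = w ^+ 2 + s by rewrite sqr_sqrtr// addr_ge0// sqr_ge0.
have wq : `|w| <= q by rewrite -sqrtr_sqr ler_sqrt ?lerDl// addr_ge0// sqr_ge0.
rewrite lerBlDr -(@ger0_norm _ (`|u - w| + q)) ?addr_ge0// -sqrtr_sqr.
rewrite ler_sqrt ?sqr_ge0// sqrrD real_normK ?num_real// qE.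
have : (u - w) * w <= `|u - w| * q.
  rewrite (le_trans (ler_norm _))// normrM ler_wpM2l//.
by rewrite -mulrnAl; nra.
Qed.

(** Fix all coordinates but the first: the norm is a 1-Lipschitz function of the
first coordinate, so it cannot map a null set onto a set of positive measure. *)
Lemma volume_radial_gt0 (R : realType) (d : nat) (D : set R) :
  measurable D -> (0 < lebesgue_measure (D `&` `[0%R, +oo[))%E ->
  (0 < volume [set x : 'rV[R]_d.+1 | D (enorm x)])%E.
Proof.
move=> mD D0; rewrite lt0e measure_ge0 andbT; apply/negP => /eqP S0.
have [e [e0 De]] : exists e : R, 0 < e /\ lebesgue_measure (D `&` `[e, +oo[) <> 0%E.
  apply: contrapT => H; move: D0; apply/negP; rewrite -leNgt.
  have mDe r : measurable (D `&` `[r, +oo[) by exact: measurableI.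
  pose F n := D `&` `[n.+1%:R^-1, +oo[%classic.
  have mF : measurable (\bigcup_n F n).
    by apply: bigcupT_measurable => n; exact: mDe.
  apply: (@le_trans _ _ (lebesgue_measure ([set 0] `|` \bigcup_n F n))).
    apply: le_measure; rewrite ?inE//.
    - exact: mDe.
    - by apply: measurableU mF; exact: measurable_set1.
    move=> r [Dr /=]; rewrite in_itv/= andbT le_eqVlt => /orP[/eqP <-|r0]; first by left.
    right; exists (Num.bound r^-1) => //; split => //=.
    rewrite in_itv/= andbT -[leRHS]invrK lef_pV2 ?posrE ?invr_gt0//.
    by rewrite ltW// (lt_le_trans (archi_boundP _)) ?invr_ge0 ?(ltW r0)// ler_nat.
  apply: (le_trans (measureU2 _ _ _)).
  - exact: measurable_set1.
  - exact: mF.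
  rewrite [X in (X + _)%E]lebesgue_measure_set1 add0e.
  apply: (le_trans (outer_measure_sigma_subadditive _ _)).
  rewrite eseries0// => n _ _; apply: contrapT => Fn; apply: H.
  by exists n.+1%:R^-1.
pose S := [set p : R * 'rV[R]_d | D (enorm (rowvec_cons p))].
have mS : measurable S.
  rewrite -[X in measurable X]setTI; apply: (measurableT_comp (f := @enorm R d.+1)) => //.
    exact: measurable_enorm.
  exact: measurable_rowvec_cons.
have SE : (\int[volume (d := d)]_v lebesgue_measure (ysection S v) = 0)%E by exact: S0.
have := measure0_of_integral0 measurableT (measurable_fun_ysection lebesgue_measure mS) _ SE.
rewrite setTI => /(_ (fun _ _ => measure_ge0 _ _)).
pose del := e / d.+1%:R.
have del0 : 0 < del by rewrite divr_gt0.
set N := [set v | _] => N0.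
pose B : set 'rV[R]_d := box (const_mx (- del)) (const_mx del).
have : (volume B <= volume N)%E.
  apply: le_measure; rewrite ?inE.
  - exact: measurable_box.
  - have -> : N = (fun v => lebesgue_measure (ysection S v)) @^-1` `]0%E, +oo[%classic.
      by apply/seteqP; split => x /=; rewrite in_itv/= andbT.
    rewrite -[X in measurable X]setTI.
    by apply: (measurable_fun_ysection lebesgue_measure mS) => //; exact: emeasurable_itv.
  move=> v vb; rewrite /N /= lt0e measure_ge0 andbT; apply/negP => /eqP Sv0.
  apply: De.
  pose s := \sum_i v ord0 i ^+ 2.
  have s0 : 0 <= s by apply: sumr_ge0 => i _; exact: sqr_ge0.
  have se : s <= e ^+ 2.
    apply: (@le_trans _ _ (\sum_(i < d) del ^+ 2)).
      apply: ler_sum => i _; have /andP[] := vb i; rewrite !mxE => h1 h2.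
      by rewrite -(@real_normK _ (v ord0 i)) ?num_real// ler_pXn2r ?nnegrE ?(ltW del0)// ler_norml !ltW.
    rewrite sumr_const card_ord /del expr_div_n -[leLHS]mulr_natr mulrAC ler_pdivrMr ?exprn_gt0//.
    rewrite ler_pM2l ?exprn_gt0// -natrX ler_nat.
    by rewrite (leq_trans (leqnSn d))// leq_pmull.
  apply: (@lipschitz_null_image R (fun t => Num.sqrt (t ^+ 2 + s)) (ysection S v)) => //.
  - by move=> x y; exact: sqrt_sumsq_lipschitz.
  - move=> r [Dr /=]; rewrite in_itv/= andbT => er.
    have r0 : 0 <= r by rewrite (le_trans _ er)// ltW.
    have E : Num.sqrt (Num.sqrt (r ^+ 2 - s) ^+ 2 + s) = r.
      rewrite sqr_sqrtr ?subrK ?sqrtr_sqr ?ger0_norm// subr_ge0 (le_trans se)//.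
      by rewrite ler_pXn2r ?nnegrE// ltW.
    exists (Num.sqrt (r ^+ 2 - s)) => //; rewrite /ysection /= inE /S /=.
    rewrite /enorm big_ord_recl mxE unlift_none /=.
    under eq_bigr do rewrite mxE liftK /=.
    by rewrite E.
  - exact: measurableI.
rewrite N0 volume_box; last by move=> i; rewrite !mxE; lra.
rewrite lee_fin leNgt; apply/negP/negPn; apply: prodr_gt0 => i _; rewrite !mxE; lra.
Qed.

(** * Measurable functionals of a spatial graph *)

(** A continuous function positive exactly on an open box: the vague topology
only gives access to the points of a graph through such functions. *)
Definition tent (R : realType) (d : nat) (a b x : 'rV[R]_d) : R :=
  \prod_(i < d) (Num.max (x ord0 i - a ord0 i) 0 * Num.max (b ord0 i - x ord0 i) 0).

Lemma tent_ge0 (R : realType) (d : nat) (a b x : 'rV[R]_d) : 0 <= tent a b x.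
Proof. by apply: prodr_ge0 => i _; rewrite mulr_ge0// le_max lexx orbT. Qed.

Lemma tent_gt0 (R : realType) (d : nat) (a b : 'rV[R]_d) :
  [set x | 0 < tent a b x] = box a b.
Proof.
apply/seteqP; split => x /=; last first.
  move=> h; apply: prodr_gt0 => i _; have /andP[h1 h2] := h i.
  by apply: mulr_gt0; rewrite lt_max subr_gt0 ?h1 ?h2.
rewrite lt_neqAle tent_ge0 andbT eq_sym => /prodf_neq0 h i.
have := h i isT; rewrite mulf_eq0 negb_or => /andP[].
have aux (t : R) : Num.max t 0 != 0 -> 0 < t.
  by case: (ltP 0 t) => //; rewrite eqxx.
by move=> /aux + /aux; rewrite !subr_gt0 => -> ->.
Qed.

Lemma continuous_tent (R : realType) (d : nat) (a b : 'rV[R]_d) :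
  continuous (tent a b).
Proof.
apply: (@continuous_big R) => [|i _ x]; first exact: mul_continuous.
have max0 (f : 'rV[R]_d -> R) : {for x, continuous f} ->
    {for x, continuous (fun y => Num.max (f y) 0)}.
  by move=> cf; apply: (@continuous_max R _ f (fun=> 0)) => //; exact: (@cst_continuous _ _ (0 : R)).
have cx : {for x, continuous (fun y : 'rV[R]_d => y ord0 i)} by exact: coord_continuous.
have cc (c : R) : {for x, continuous (fun _ : 'rV[R]_d => c)} by apply: cst_continuous.
have c1 := max0 _ (continuousB cx (cc (a ord0 i))).
have c2 := max0 _ (continuousB (cc (b ord0 i)) cx).
exact: (continuousM c1 c2).
Qed.

Lemma compact_closed_box (R : realType) (d : nat) (a b : 'rV[R]_d) :
  compact [set x : 'rV[R]_d | forall i, `[a ord0 i, b ord0 i]%classic (x ord0 i)].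
Proof.
exact: (@rV_compact R d (fun i => `[a ord0 i, b ord0 i]%classic)
  (fun i => @segment_compact R _ _)).
Qed.

Lemma sub_closed_box (R : realType) (d : nat) (a b : 'rV[R]_d) :
  box a b `<=` [set x : 'rV[R]_d | forall i, `[a ord0 i, b ord0 i]%classic (x ord0 i)].
Proof.
by move=> x h i /=; have /andP[h1 h2] := h i; rewrite in_itv/= !ltW.
Qed.

Lemma cont_compact_support_bounded (R : realType) (T : topologicalType)
    (f : T -> R) (K : set T) :
  hausdorff_space T -> continuous f -> compact K ->
  [set x | f x != 0] `<=` K -> cont_compact_support f.
Proof.
move=> hT cf cK fK; split => //.
apply: (subclosed_compact _ cK); first exact: closed_closure.
have /closure_id -> : closed K by exact: compact_closed.
exact: closure_subset.
Qed.

Lemma measurable_vertex_sum (R : realType) (d : nat) (f : 'rV[R]_d -> R) :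
  cont_compact_support f ->
  measurable_fun [set: spatial_graph R d] (fun G => \sum_(x \in vertices G) f x).
Proof.
move=> cf; apply: (measurability _ (RGenOpens.measurableE R)).
move=> _ [_ [x [y ->]] <-]; rewrite setTI; apply: sub_sigma_algebra.
set A := _ @^-1` _.
have hA : @vague_subbase R d A.
  by left; exists f, `]x, y[%classic; split => //; exact: itv_open.
by exists [set A]; [move=> _ ->; exact: finI_from1|rewrite bigcup_set1].
Qed.

Lemma measurable_edge_sum (R : realType) (d : nat) (f : 'rV[R]_d * 'rV[R]_d -> R) :
  cont_compact_support f ->
  measurable_fun [set: spatial_graph R d] (fun G => \sum_(e \in edges G) f e).
Proof.
move=> cf; apply: (measurability _ (RGenOpens.measurableE R)).
move=> _ [_ [x [y ->]] <-]; rewrite setTI; apply: sub_sigma_algebra.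
set A := _ @^-1` _.
have hA : @vague_subbase R d A.
  by right; exists f, `]x, y[%classic; split => //; exact: itv_open.
by exists [set A]; [move=> _ ->; exact: finI_from1|rewrite bigcup_set1].
Qed.

Lemma fsbig_gt0P (R : realType) (T : choiceType) (S : set T) (f : T -> R) :
  (forall x, 0 <= f x) -> finite_set (S `&` [set x | 0 < f x]) ->
  0 < \sum_(x \in S) f x <-> exists x, S x /\ 0 < f x.
Proof.
move=> f0 fin; rewrite -(fsbig_widen (S `&` [set x | 0 < f x]) S); last 2 first.
- by move=> x [].
- by move=> x [Sx /= nx]; apply/eqP; rewrite eq_le f0 andbT leNgt; apply/negP => fx; exact: nx.
rewrite fsbig_finite//=; split.
  move=> h; apply: contrapT => H; move: h; rewrite big_seq big1 ?ltxx// => x.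
  by rewrite in_fset_set// inE => -[Sx /= fx]; exfalso; apply: H; exists x.
move=> [x [Sx fx]]; rewrite (big_fsetD1 x)/=; last by rewrite in_fset_set// inE.
by rewrite ltr_pwDl// sumr_ge0.
Qed.

Lemma cvg_min_count (R : realType) (T : choiceType) (S : set T) (f : T -> R) :
  (forall x, 0 <= f x) -> finite_set (S `&` [set x | 0 < f x]) ->
  (\sum_(x \in S) Num.min (n%:R * f x) 1) @[n --> \oo] -->
  (#|` fset_set (S `&` [set x | 0 < f x]) |%:R : R).
Proof.
move=> f0 fin; set U := S `&` _.
have -> : (fun n : nat => \sum_(x \in S) Num.min (n%:R * f x) 1) =
    (fun n => \sum_(x <- fset_set U | x \in fset_set U) Num.min (n%:R * f x) 1).
  apply/funext => n; rewrite -big_seq -(fsbig_widen U S); last 2 first.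
  - by move=> x [].
  - move=> x [Sx /= nx].
    have -> : f x = 0 by apply/eqP; rewrite eq_le f0 andbT leNgt; apply/negP => fx; exact: nx.
    by rewrite /= mulr0 min_l.
  by rewrite fsbig_finite.
have -> : (#|` fset_set U |%:R : R) = \sum_(x <- fset_set U | x \in fset_set U) 1.
  by rewrite -big_seq big_const_seq count_predT iter_addr addr0.
apply: cvg_big => [|x xU]; first exact: add_continuous.
apply: cvg_near_cst; near=> n; rewrite min_r//.
have fx : 0 < f x by move: xU; rewrite in_fset_set// inE => -[].
rewrite -ler_pdivrMr// mul1r.
near: n; exists (Num.bound (f x)^-1) => // n /= nb.
by rewrite ltW// (lt_le_trans (archi_boundP _)) ?invr_ge0 ?(ltW fx)// ler_nat.
Unshelve. all: by end_near. Qed.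

Lemma finite_vertices_box (R : realType) (d : nat) (G : spatial_graph R d) a b :
  finite_set (vertices G `&` box a b).
Proof.
have := @vertices_locally_finite _ _ G _ (@compact_closed_box R d a b).
by apply: sub_finite_set; apply: setIS; exact: sub_closed_box.
Qed.

Lemma counting_finite (R : realType) (T : choiceType) (A : set T) :
  finite_set A -> counting A = (#|` fset_set A|%:R)%:E :> \bar R.
Proof. by move=> fA; rewrite /counting asboolT. Qed.

Lemma measurable_count_box (R : realType) (d : nat) (a b : 'rV[R]_d) :
  measurable_fun [set: spatial_graph R d]
    (fun G => counting (vertices G `&` box a b) : \bar R).
Proof.
pose f (n : nat) (x : 'rV[R]_d) := Num.min (n%:R * tent a b x) 1.
have cf n : cont_compact_support (f n).
  apply: (cont_compact_support_bounded (@norm_hausdorff _ _) _ (@compact_closed_box R d a b)).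
    move=> x; apply: (@continuous_min R _ (fun x : 'rV[R]_d => n%:R * tent a b x) (fun=> 1)).
      have c1 : {for x, continuous (fun _ : 'rV[R]_d => n%:R : R)} by apply: cst_continuous.
      by apply: (continuousM c1); exact: continuous_tent.
    exact: (@cst_continuous _ _ (1 : R)).
  move=> x /= fx; apply: sub_closed_box; rewrite -tent_gt0 /= lt_neqAle tent_ge0 andbT eq_sym.
  by apply: contra fx => /eqP bx; rewrite /f bx mulr0 min_l.
have mf : measurable_fun [set: spatial_graph R d]
    (fun G => #|` fset_set (vertices G `&` box a b)|%:R : R).
  apply: (@measurable_fun_cvg _ _ _ _ (fun n G => \sum_(x \in vertices G) f n x)).
    by move=> n; exact: measurable_vertex_sum.
  move=> G _; rewrite -tent_gt0; apply: cvg_min_count; first exact: tent_ge0.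
  by rewrite tent_gt0; exact: finite_vertices_box.
rewrite (_ : (fun G => _) =
   EFin \o (fun G : spatial_graph R d => #|` fset_set (vertices G `&` box a b)|%:R)).
  exact: measurableT_comp.
by apply/funext => G; rewrite counting_finite//; exact: finite_vertices_box.
Qed.

Lemma finite_set_measurable_rowvec (R : realType) (d : nat) (A : set 'rV[R]_d) :
  finite_set A -> measurable A.
Proof.
move=> fA; have -> : A = \bigcup_(x in A) [set x].
  by apply/seteqP; split => [x Ax|x [y Ay ->]] //; exists x.
by apply: fin_bigcup_measurable => // x _; exact: measurable_rowvec1.
Qed.

(** The vertices in a box are finitely many, so the count of a Borel part is a
finite measure in that part: a Dynkin argument extends measurability from boxes. *)
Lemma measurable_count (R : realType) (d : nat) (a b : 'rV[R]_d) (C : set 'rV[R]_d) :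
  measurable C ->
  measurable_fun [set: spatial_graph R d]
    (fun G => counting (vertices G `&` (C `&` box a b)) : \bar R).
Proof.
have fin (G : spatial_graph R d) A : finite_set (vertices G `&` (A `&` box a b)).
  by apply: sub_finite_set (finite_vertices_box G a b); apply: setIS; exact: subIsetr.
have mfin G A := finite_set_measurable_rowvec (fin G A).
have mbox G := finite_set_measurable_rowvec (finite_vertices_box G a b).
rewrite measurable_rowvec_boxes.
apply: (dynkin_induction (P := fun C => measurable_fun [set: spatial_graph R d]
    (fun G => counting (vertices G `&` (C `&` box a b)) : \bar R))).
- exact: measurable_rowvec_boxes.
- exact: setI_closed_boxes.
- by under eq_fun do rewrite setTI; exact: measurable_count_box.
- move=> _ [a1 [b1 ->]].
  have [a2 [b2 E]] : exists a2 b2, box a1 b1 `&` box a b = box a2 b2.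
    by apply: setI_closed_boxes; do 2 eexists.
  by rewrite E; exact: measurable_count_box.
- move=> A mA hA.
  rewrite (_ : (fun G => _) = (fun G : spatial_graph R d =>
     counting (vertices G `&` box a b) - counting (vertices G `&` (A `&` box a b)))%E).
    by apply: emeasurable_funB => //; exact: measurable_count_box.
  apply/funext => G.
  have -> : vertices G `&` (~` A `&` box a b) =
      (vertices G `&` box a b) `\` (vertices G `&` (A `&` box a b)).
    apply/seteqP; split => x /=; first by move=> [Gx [nA bx]]; split => // -[_ []].
    by move=> [[Gx bx] h]; split => //; split => // Ax; exact: h.
  rewrite (measureD (mu := @counting _ R)) //.
    by congr (_ - counting _)%E; apply/seteqP; split => x /=; tauto.
  have : (counting (vertices G `&` box a b) < +oo :> \bar R)%E.
    by rewrite counting_finite ?ltry//; exact: finite_vertices_box.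
  by [].
- move=> F mF tF hF.
  rewrite (_ : (fun G => _) = (fun G : spatial_graph R d =>
     \sum_(n <oo) counting (vertices G `&` (F n `&` box a b)))%E).
    by apply: ge0_emeasurable_sum => // n G _ _; exact: measure_ge0.
  apply/funext => G; rewrite setI_bigcupl setI_bigcupr.
  rewrite measure_bigcup//.
  + by apply: eq_eseriesl => n; rewrite in_setT.
  + apply/trivIsetP => i j _ _ ij; rewrite -setIIr; apply/seteqP; split => // x.
    move=> [_ [[Fi _] [Fj _]]].
    by have /trivIsetP/(_ i j I I ij)/seteqP[/(_ x) h _] := tF; apply: h; split.
Qed.

Definition single_vertex (R : realType) (d : nat) (B : set 'rV[R]_d) :
    set (spatial_graph R d) :=
  [set G | counting (vertices G `&` B) = 1%E :> \bar R].

(** The default value 0 away from [single_vertex B] makes this a total measurable map. *)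
Definition vertex_in (R : realType) (d : nat) (B : set 'rV[R]_d) (G : spatial_graph R d)
    : 'rV[R]_d :=
  if `[< single_vertex B G >] then xget 0 (vertices G `&` B) else 0.

Lemma counting1P (R : realType) (T : choiceType) (A : set T) :
  counting A = 1%E :> \bar R <-> exists x, A = [set x].
Proof.
split=> [|[x ->]]; last by rewrite counting_finite// fset_set1 cardfs1.
rewrite /counting; case: asboolP => // fA [] /eqP.
rewrite -[1](mulr1n 1) eqr_nat => /cardfs1P[x Ax]; exists x.
by rewrite -(fset_setK fA) Ax; apply/seteqP; split => y /=; rewrite inE => /eqP.
Qed.

Lemma single_vertexP (R : realType) (d : nat) (B : set 'rV[R]_d) (G : spatial_graph R d) :
  single_vertex B G -> vertices G `&` B = [set vertex_in B G].
Proof.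
move=> sG; rewrite /vertex_in asboolT//.
have [x E] := (counting1P R _).1 sG.
rewrite E; congr [set _].
have : [set x] (xget 0 [set x]) by apply: xgetPex; exists x.
by move=> /= ->.
Qed.

Lemma single_vertexE (R : realType) (d : nat) (B C : set 'rV[R]_d) (G : spatial_graph R d) :
  single_vertex B G -> C (vertex_in B G) <-> single_vertex (C `&` B) G.
Proof.
move=> sG; have E := single_vertexP sG; rewrite /single_vertex /=.
rewrite (_ : vertices G `&` (C `&` B) = C `&` [set vertex_in B G]); last first.
  by rewrite -E setIA [vertices G `&` C]setIC setIA.
split=> [Cy|/counting1P[x /seteqP[_ /(_ x erefl)[Cx /= <-]]]//].
apply/counting1P; exists (vertex_in B G); apply/seteqP; split => x /=; first by case.
by move=> ->.
Qed.

Lemma measurable_single_vertex (R : realType) (d : nat) (a b : 'rV[R]_d) (C : set 'rV[R]_d) :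
  measurable C -> measurable (single_vertex (C `&` box a b)).
Proof.
move=> mC; have := measurable_count a b mC measurableT (emeasurable_set1 1%E).
by rewrite setTI.
Qed.

Lemma measurable_single_vertex_box (R : realType) (d : nat) (a b : 'rV[R]_d) :
  measurable (single_vertex (box a b)).
Proof. by rewrite -(setTI (box a b)); exact: measurable_single_vertex. Qed.

Lemma measurable_vertex_in (R : realType) (d : nat) (a b : 'rV[R]_d) :
  measurable_fun [set: spatial_graph R d] (vertex_in (box a b)).
Proof.
move=> _ C mC; rewrite setTI.
have -> : vertex_in (box a b) @^-1` C =
    (single_vertex (box a b) `&` single_vertex (C `&` box a b)) `|`
    (~` single_vertex (box a b) `&` [set _ | C 0]).
  apply/seteqP; split => G /=.
    have [sG|nG] := pselect (single_vertex (box a b) G).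
      by move=> /(single_vertexE C sG) h; left.
    by rewrite /vertex_in asboolF// => C0; right.
  move=> [[sG h]|[nG C0]]; first exact/single_vertexE.
  by rewrite /vertex_in asboolF.
apply: measurableU; apply: measurableI.
- exact: measurable_single_vertex_box.
- exact: measurable_single_vertex.
- by apply: measurableC; exact: measurable_single_vertex_box.
- have [C0|nC0] := pselect (C 0).
    by rewrite (_ : [set _ | _] = setT)//; apply/seteqP; split.
  by rewrite (_ : [set _ | _] = set0)//; apply/seteqP; split.
Qed.

Definition linked (R : realType) (d : nat) (B B' : set 'rV[R]_d) : set (spatial_graph R d) :=
  [set G | edges G (vertex_in B G, vertex_in B' G)].

(** The sum over the edges of a product of two tents is positive exactly when some
edge joins the two boxes. *)
Lemma measurable_linked (R : realType) (d : nat) (a b a' b' : 'rV[R]_d) :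
  measurable (single_vertex (box a b) `&` single_vertex (box a' b') `&`
              linked (box a b) (box a' b')).
Proof.
pose f (e : 'rV[R]_d * 'rV[R]_d) := tent a b e.1 * tent a' b' e.2.
have f0 e : 0 <= f e by rewrite mulr_ge0// tent_ge0.
have fE : [set e | 0 < f e] = box a b `*` box a' b'.
  rewrite -!tent_gt0; apply/seteqP; split => e /=.
    by rewrite lt_neqAle f0 andbT eq_sym mulf_eq0 negb_or => /andP[h1 h2];
       rewrite !lt_neqAle !tent_ge0 ![0 == _]eq_sym h1 h2.
  by move=> [h1 h2]; exact: mulr_gt0.
have cf : cont_compact_support f.
  apply: (cont_compact_support_bounded _ _
    (compact_setX (@compact_closed_box R d a b) (@compact_closed_box R d a' b'))).
  - exact: norm_hausdorff.
  - move=> e; apply: (@continuousM R _ (tent a b \o fst) (tent a' b' \o snd)).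
      by apply: continuous_comp; [exact: cvg_fst|exact: continuous_tent].
    by apply: continuous_comp; [exact: cvg_snd|exact: continuous_tent].
  - move=> e /= fe; have : [set e | 0 < f e] e by rewrite /= lt_neqAle f0 eq_sym fe.
    by rewrite fE => -[h1 h2]; split; exact: sub_closed_box.
have fin (G : spatial_graph R d) : finite_set (edges G `&` [set e | 0 < f e]).
  rewrite fE; apply: sub_finite_set (finite_setX (finite_vertices_box G a b)
    (finite_vertices_box G a' b')).
  by move=> [x y] [/edges_vertices[/= h1 h2] [/= h3 h4]]; split.
have -> : single_vertex (box a b) `&` single_vertex (box a' b') `&`
              linked (box a b) (box a' b') =
    single_vertex (box a b) `&` single_vertex (box a' b') `&`
    (fun G => \sum_(e \in edges G) f e) @^-1` `]0, +oo[.
  apply/seteqP; split => G [[s1 s2] h]; split => //.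
    rewrite /= in_itv/= andbT; apply/(fsbig_gt0P f0 (fin G)).
    exists (vertex_in (box a b) G, vertex_in (box a' b') G); split => //.
    have : [set e | 0 < f e] (vertex_in (box a b) G, vertex_in (box a' b') G); last by [].
    rewrite fE; split => /=.
      by have /seteqP[_ /(_ _ erefl)[]] := single_vertexP s1.
    by have /seteqP[_ /(_ _ erefl)[]] := single_vertexP s2.
  move: h; rewrite /= in_itv/= andbT => /(fsbig_gt0P f0 (fin G))[[x y] [Gxy fxy]].
  have : [set e | 0 < f e] (x, y) by [].
  rewrite fE => -[/= Bx By]; have [/= Gx Gy] := edges_vertices Gxy.
  rewrite /linked /=.
  have /seteqP[/(_ x) + _] := single_vertexP s1; rewrite /= => <- //.
  by have /seteqP[/(_ y) + _] := single_vertexP s2; rewrite /= => <-.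
apply: measurableI.
  by apply: measurableI; exact: measurable_single_vertex_box.
by rewrite -[X in measurable X]setTI; exact: measurable_edge_sum.
Qed.

(** * The law of the vertices *)

Lemma counting0P (R : realType) (T : choiceType) (A : set T) :
  counting A = 0%E :> \bar R <-> A = set0.
Proof.
split=> [|->]; last by rewrite counting_finite// fset_set0 cardfs0.
rewrite /counting; case: asboolP => // fA [] /eqP.
by rewrite pnatr_eq0 cardfs_eq0 => /eqP /fset_set_set0; exact.
Qed.

(** Law of the vertex of a Poisson process in [box a b], on the event that this
vertex is unique: a uniform point of the box, with the probability of that event
as total mass. The absolute value makes the factor nonnegative for every lambda. *)
Definition point_law (R : realType) (d : nat) (lambda : R) (a b : 'rV[R]_d) :
    set 'rV[R]_d -> \bar R :=
  mscale (`|lambda| * expR (- (lambda * fine (volume (box a b)))))%:nng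
    (mrestr (@volume R d) (measurable_box a b)).
HB.instance Definition _ R d lambda a b := Measure.on (@point_law R d lambda a b).

Lemma point_lawE (R : realType) (d : nat) (lambda : R) (a b : 'rV[R]_d) C :
  point_law lambda a b C =
  ((`|lambda| * expR (- (lambda * fine (volume (box a b)))))%:E *
   volume (C `&` box a b))%E.
Proof. by []. Qed.

Lemma point_law_fin (R : realType) (d : nat) (lambda : R) (a b : 'rV[R]_d) :
  fin_num_fun (point_law lambda a b).
Proof.
move=> C mC; rewrite point_lawE fin_numM// ge0_fin_numE//.
apply: (le_lt_trans _ (volume_box_lty a b)); apply: le_measure; rewrite ?inE.
- by apply: measurableI => //; exact: measurable_box.
- exact: measurable_box.
- exact: subIsetr.
Qed.
HB.instance Definition _ R d lambda a b :=
  @Measure_isFinite.Build _ _ _ (@point_law R d lambda a b) (@point_law_fin R d lambda a b).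

Section poisson_vertices.
Context (R : realType) (dO : measure_display) (Omega : measurableType dO).
Variables (P : probability Omega R) (d : nat) (lambda : R).

Lemma poisson_counts (Phi : Omega -> set 'rV[R]_d) (J : finType)
    (B : J -> set 'rV[R]_d) (k : J -> nat) :
  homogeneous_poisson P lambda Phi ->
  (forall i, measurable (B i) /\ (vol R d (B i) < +oo)%E) ->
  trivIset [set: J] B ->
  P (\bigcap_(i in [set: J])
       [set w | counting (Phi w `&` B i) = (k i)%:R%:E :> \bar R]) =
  (\prod_(i : J)
     let m := lambda * fine (vol R d (B i)) in
     expR (- m) * m ^+ k i / (k i)`!%:R)%:E.
Proof.
move=> hP mB tB.
have tB' : trivIset [set: 'I_#|J|] (fun i => B (enum_val i)).
  move=> i j _ _ ne; apply: enum_val_inj; exact: tB.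
have := hP _ (fun i => B (enum_val i)) (fun i => k (enum_val i)) (fun i => mB _) tB'.
rewrite (reindex (@enum_val J xpredT)) /=; last exact/onW_bij/enum_val_bij.
move=> <-; congr (P _); apply/seteqP; split => w h i _ /=; first exact: (h (enum_val i)).
by have := h (enum_rank i) I; rewrite /= enum_rankK.
Qed.

Variable G : {mfun Omega >-> spatial_graph R d}.
Hypotheses (lambda_gt0 : 0 < lambda)
  (hP : homogeneous_poisson P lambda (fun w => vertices (G w))).

(** The unique vertices in disjoint boxes are independent: the event below asks for
one vertex in each part C i and none in the rest of the box. *)
Lemma poisson_single_vertices (J : finType) (a b : J -> 'rV[R]_d)
    (C : J -> set 'rV[R]_d) :
  trivIset [set: J] (fun i => box (a i) (b i)) -> (forall i, measurable (C i)) ->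
  P (G @^-1` \bigcap_(i in [set: J])
       (single_vertex (box (a i) (b i)) `&` vertex_in (box (a i) (b i)) @^-1` C i)) =
  (\prod_(i : J) point_law lambda (a i) (b i) (C i))%E.
Proof.
move=> tB mC.
pose B i := box (a i) (b i).
have mB i : measurable (B i) by exact: measurable_box.
pose D (p : J * bool) := if p.2 then C p.1 `&` B p.1 else B p.1 `\` C p.1.
pose k (p : J * bool) := nat_of_bool p.2.
have DB p : D p `<=` B p.1 by case: p => i [] x /= [].
have mD p : measurable (D p).
  by case: p => i [] /=; [exact: measurableI|exact: measurableD].
have volD p : (volume (D p) < +oo)%E.
  apply: (le_lt_trans _ (volume_box_lty (a p.1) (b p.1))).
  apply: le_measure; rewrite ?inE//; exact: (mB p.1).
have tD : trivIset [set: J * bool] D.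
  move=> [i s] [j t] _ _ [x [Dx Dx']].
  have ij : i = j by apply: tB => //; exists x; split; [exact: (DB _ _ Dx)|exact: (DB _ _ Dx')].
  rewrite ij; congr pair; move: Dx Dx'; rewrite ij.
  by case: s; case: t => //= -[? ?] [? ?].
have := poisson_counts k hP (fun p => conj (mD p) (volD p)) tD.
rewrite [X in X = _ -> _](_ : _ = P (G @^-1` \bigcap_(i in [set: J])
       (single_vertex (B i) `&` vertex_in (B i) @^-1` C i))); last first.
  congr (P _); apply/seteqP; split => w h.
    move=> i _.
    have /counting1P[x E1] := h (i, true) I.
    have /counting0P E0 := h (i, false) I.
    rewrite /= in E0 E1.
    have E : vertices (G w) `&` B i = [set x].
      rewrite -E1; apply/seteqP; split => y [Gy]; last by case.
      move=> By; split => //; split => //; apply: contrapT => nC.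
      by have /seteqP[/(_ y)+ _] := E0; apply.
    have sB : single_vertex (B i) (G w) by apply/counting1P; exists x.
    split; first exact: sB.
    by apply/(single_vertexE (C i) sB)/counting1P; exists x.
  move=> [i s] _; have [sB /(single_vertexE _ sB) sC] := h i I.
  case: s => //=; apply/counting0P; apply/seteqP; split => // y [Gy [By nCy]].
  apply: nCy; have [x E] := (counting1P R _).1 sC; have [z F] := (counting1P R _).1 sB.
  have /seteqP[_ /(_ x erefl) [Gx [Cx Bx]]] := E.
  have /seteqP[/(_ y) + _] := F; rewrite /= => -> //.
  by have /seteqP[/(_ x) + _] := F; rewrite /= => <-.
rewrite /B => ->.
rewrite -(pair_bigA _ (fun i s => expR (- (lambda * fine (vol R d (D (i, s))))) *
  (lambda * fine (vol R d (D (i, s)))) ^+ k (i, s) / (k (i, s))`!%:R))/=.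
rewrite -prodEFin; apply: eq_bigr => i _; rewrite big_bool/=.
rewrite point_lawE /k /D /= expr1 expr0 !divr1 mulr1 gtr0_norm//.
have E : volume (box (a i) (b i)) = (volume (C i `&` B i) + volume (B i `\` C i))%E.
  rewrite -measureU//; last 3 first.
  - exact: measurableI.
  - exact: measurableD.
  - by apply/seteqP; split => // x [[? ?] [? ?]].
  congr (volume _); apply/seteqP; split => x /=; last by case=> -[].
  by have [Cx|nCx] := pselect (C i x); [left|right].
have f1 : volume (C i `&` B i) \is a fin_num by rewrite ge0_fin_numE// (volD (i, true)).
have f2 : volume (B i `\` C i) \is a fin_num by rewrite ge0_fin_numE// (volD (i, false)).
rewrite E fineD// mulrDr opprD expRD -[X in (_ * X)%E]fineK// -EFinM -/(volume _) -/(volume _).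
congr EFin; rewrite -![vol R d _]/(volume _); ring.
Qed.

End poisson_vertices.

(** * Conditional edge probabilities *)

Section measure_helpers.
Context d (T : measurableType d) (R : realType) (mu : {measure set T -> \bar R}).

Lemma measure_eq_off_null (N A B : set T) :
  measurable N -> mu N = 0%E -> measurable A -> measurable B ->
  A `\` N = B `\` N -> mu A = mu B.
Proof.
move=> mN N0 mA mB AB.
suff h C : measurable C -> mu C = mu (C `\` N) by rewrite h// AB -h.
move=> mC; rewrite (measureDI mu mC mN).
rewrite [X in (_ + X)%E](_ : _ = 0%E) ?adde0//.
by apply: (subset_measure0 (B := N)) => //; exact: measurableI.
Qed.

Lemma integral_eq_off_null (N A B : set T) (f g : T -> \bar R) :
  measurable N -> mu N = 0%E -> measurable A -> measurable B ->
  measurable_fun setT f -> measurable_fun setT g ->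
  (forall x, (0 <= f x)%E) -> (forall x, (0 <= g x)%E) ->
  A `\` N = B `\` N -> (forall x, A x -> ~ N x -> f x = g x) ->
  (\int[mu]_(x in A) f x = \int[mu]_(x in B) g x)%E.
Proof.
move=> mN N0 mA mB mf mg f0 g0 AB fg.
rewrite (ge0_negligible_integral (N := N))//; last exact: measurable_funTS.
rewrite [RHS](ge0_negligible_integral (N := N))//; last exact: measurable_funTS.
by rewrite -AB; apply: eq_integral => x; rewrite inE => -[Ax Nx]; exact: fg.
Qed.

(** Countable additivity of both sides over a partition of almost all the space. *)
Lemma measure_integral_partition (D : (set T)^nat) (N S E : set T) (f : T -> \bar R) :
  (forall n, measurable (D n)) -> trivIset setT D ->
  measurable N -> mu N = 0%E -> measurable S -> measurable E ->
  S `\` N `<=` \bigcup_n D n -> E `\` N `<=` \bigcup_n D n ->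
  measurable_fun setT f -> (forall x, (0 <= f x)%E) ->
  (forall n, mu (S `&` D n) = \int[mu]_(x in E `&` D n) f x)%E ->
  (mu S = \int[mu]_(x in E) f x)%E.
Proof.
move=> mD tD mN N0 mS mE SD ED mf f0 SE.
have mU : measurable (\bigcup_n D n) by exact: bigcupT_measurable.
have tI A : trivIset setT (fun n => A `&` D n).
  by apply: trivIset_setIl.
rewrite (@measure_eq_off_null N S (\bigcup_n (S `&` D n)))//; last 2 first.
- by apply: bigcupT_measurable => n; exact: measurableI.
- rewrite -setI_bigcupr; apply/seteqP; split => x [Sx Nx]; last by case: Sx.
  by split => //; split => //; apply: SD.
rewrite (@integral_eq_off_null N E (\bigcup_n (E `&` D n)) f f)//; last 2 first.
- by apply: bigcupT_measurable => n; exact: measurableI.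
- rewrite -setI_bigcupr; apply/seteqP; split => x [Ex Nx]; last by case: Ex.
  by split => //; split => //; apply: ED.
rewrite ge0_integral_bigcup//; last 2 first.
- by move=> n; exact: measurableI.
- exact: measurable_funTS.
rewrite measure_bigcup//; last by move=> n _; exact: measurableI.
by under eq_eseriesl do rewrite in_setT; apply: eq_eseriesr => n _; exact: SE.
Qed.

End measure_helpers.

Section configurations.
Context (R : realType) (d : nat) (J : finType).

(** Measurability for the product sigma-algebra on configurations of points indexed
by J, phrased through families of random points so that it transfers to any
sigma-algebra on the source. *)
Definition measurable_config (A : set (J -> 'rV[R]_d)) : Prop :=
  forall dW (W : measurableType dW) (Y : J -> W -> 'rV[R]_d),
    (forall i, measurable_fun setT (Y i)) -> measurable [set w | A (fun i => Y i w)].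

Definition measurable_statistic (F : (J -> 'rV[R]_d) -> R) : Prop :=
  forall dW (W : measurableType dW) (Y : J -> W -> 'rV[R]_d),
    (forall i, measurable_fun setT (Y i)) ->
    measurable_fun setT (fun w => F (fun i => Y i w)).

Definition has_edges (E : seq (J * J)) (x : J -> 'rV[R]_d) (g : spatial_graph R d) :=
  forall p, p \in E -> edges g (x p.1, x p.2).

Variables a b : J -> 'rV[R]_d.

Definition box_vertices (g : spatial_graph R d) (i : J) : 'rV[R]_d :=
  vertex_in (box (a i) (b i)) g.

Definition all_single : set (spatial_graph R d) :=
  \bigcap_(i in [set: J]) single_vertex (box (a i) (b i)).

Definition cell_event (A : set (J -> 'rV[R]_d)) : set (spatial_graph R d) :=
  all_single `&` [set g | A (box_vertices g)].

Definition pattern_event (A : set (J -> 'rV[R]_d)) (E : seq (J * J)) :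
    set (spatial_graph R d) :=
  cell_event A `&` [set g | has_edges E (box_vertices g) g].

Lemma measurable_cell_event A : measurable_config A -> measurable (cell_event A).
Proof.
move=> mA; apply: measurableI.
  by apply: fin_bigcap_measurable => // i _; exact: measurable_single_vertex_box.
apply: (mA _ _ (fun i g => vertex_in (box (a i) (b i)) g)) => i.
exact: measurable_vertex_in.
Qed.

Lemma measurable_pattern_event A E : measurable_config A ->
  measurable (pattern_event A E).
Proof.
move=> mA; elim: E => [|p E IH].
  rewrite (_ : pattern_event A [::] = cell_event A); first exact: measurable_cell_event.
  by apply/seteqP; split => g //= [].
rewrite (_ : pattern_event A (p :: E) = pattern_event A E `&`
  (single_vertex (box (a p.1) (b p.1)) `&` single_vertex (box (a p.2) (b p.2)) `&`
   linked (box (a p.1) (b p.1)) (box (a p.2) (b p.2)))).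
  by apply: measurableI => //; exact: measurable_linked.
apply/seteqP; split => g.
  move=> [[sg Ag] h]; split.
    by split => // q qE; apply: h; rewrite inE qE orbT.
  by split; [split; exact: sg|apply: h; rewrite inE eqxx].
move=> [[[sg Ag] h] [_ l]]; split => // q.
by rewrite inE => /orP[/eqP ->|/h].
Qed.

End configurations.

Section edge_formula.
Context (R : realType) (dO : measure_display) (Omega : measurableType dO).
Variables (P : probability Omega R) (d : nat).
Variables (G : {mfun Omega >-> spatial_graph R d}) (X : nat -> {mfun Omega >-> 'rV[R]_d}).
Variable J : finType.

(** The common feature of both models: given the locations, the conditional probability
of a pattern of edges is a function F of the locations of its vertices. Apart from
the Poisson law of the vertices, the argument uses nothing else of a model. *)
Definition edge_law (E : seq (J * J)) (F : (J -> 'rV[R]_d) -> R) : Prop :=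
  forall j : J -> nat, injective j ->
    measurable [set w | has_edges E (fun i => X (j i) w) (G w)] /\
    forall B, sigma_of X B ->
      P (B `&` [set w | has_edges E (fun i => X (j i) w) (G w)]) =
      (\int[P]_(w in B) (F (fun i => X (j i) w))%:E)%E.

Variables a b : J -> 'rV[R]_d.
Hypothesis tB : trivIset [set: J] (fun i => box (a i) (b i)).
Let B i := box (a i) (b i).

(* Excluding all other points makes j unique, and the event is still determined by the
   locations. *)
Let labelled (j : {ffun J -> nat}) : set Omega :=
  \bigcap_(i in [set: J]) (X (j i) @^-1` B i `&`
    \bigcap_(n in [set n | n <> j i]) ~` (X n @^-1` B i)).

Let sigmaX n C : measurable C -> sigma_of X (X n @^-1` C).
Proof.
move=> mC; apply: sub_sigma_algebra; exists n => //; exists C => //.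
by rewrite setTI.
Qed.

Let sigma_labelled j : sigma_of X (labelled j).
Proof.
pose W := g_sigma_algebraType (\bigcup_i g_sigma_algebra_preimage (X i)).
suff : @measurable _ W (labelled j) by [].
apply: fin_bigcap_measurable => // i _; apply: measurableI.
  by apply: sigmaX; exact: measurable_box.
apply: bigcap_measurableType => n _; apply: measurableC.
by apply: sigmaX; exact: measurable_box.
Qed.

Let sigma_measurable C : sigma_of X C -> measurable C.
Proof.
apply: smallest_sub; first exact: sigma_algebra_measurable.
by move=> _ [n _ [D mD <-]]; exact: measurable_funPT.
Qed.

Let labelled_inj j w : labelled j w -> injective j.
Proof.
move=> h i i' ii'; apply: tB => //; exists (X (j i) w).
by split; [have [] := h i I|rewrite ii'; have [] := h i' I].
Qed.

Let labelled_uniq j j' w : labelled j w -> labelled j' w -> j = j'.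
Proof.
move=> h h'; apply/ffunP => i; apply: contrapT => ne.
by have [_ /(_ _ ne)] := h' i I; apply; have [] := h i I.
Qed.

Let enumerated w :=
  injective (fun i => X i w) /\ vertices (G w) = range (fun i => X i w).

Let labelled_vertices j w : enumerated w -> labelled j w ->
  all_single a b (G w) /\ box_vertices a b (G w) = (fun i => X (j i) w).
Proof.
move=> [iX vE] h.
have E i : vertices (G w) `&` B i = [set X (j i) w].
  have [h1 h2] := h i I; apply/seteqP; split => x /=.
    rewrite vE => -[[n _ <-] Bn]; apply: contrapT => ne.
    by apply: (h2 n) => // nj; apply: ne; rewrite nj.
  by move=> ->; split => //; rewrite vE; exists (j i).
have s i : single_vertex (B i) (G w) by apply/counting1P; exists (X (j i) w).
split; first by move=> i _; exact: s.
apply/funext => i; have := single_vertexP (s i); rewrite E.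
by move=> /seteqP[_ /(_ _ erefl)].
Qed.

Let single_labelled w : enumerated w -> all_single a b (G w) ->
  exists j, labelled j w.
Proof.
move=> [iX vE] s.
have /choice[j hj] i : exists n, X n w = vertex_in (B i) (G w).
  have /seteqP[_ /(_ _ erefl) []] := single_vertexP (s i I).
  by rewrite vE => -[n _ <-] _; exists n.
exists [ffun i => j i] => i _; rewrite ffunE.
have /seteqP[h1 h2] := single_vertexP (s i I).
split; first by rewrite /= hj; have [] := h2 _ erefl.
move=> n /= ne Bn; apply: ne; apply: iX; rewrite hj.
by apply: h1; split => //; rewrite vE; exists n.
Qed.

(** The enumeration X is arbitrary, so the numbers j of the unique vertices in the boxes
are random. The event that they take given values depends on the locations only,
where [edge_law] applies, and these events form a countable partition. *)
Lemma edge_formula (A : set (J -> 'rV[R]_d)) E F :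
  enumerates_vertices P G X -> edge_law E F ->
  measurable_config A -> measurable_statistic F -> (forall x, 0 <= F x) ->
  P (G @^-1` pattern_event a b A E) =
  (\int[P]_(w in G @^-1` cell_event a b A) (F (box_vertices a b (G w)))%:E)%E.
Proof.
move=> [N [mN N0 goodN]] hE mA mF F0.
have good w : ~ N w -> enumerated w.
  by move=> Nw; apply: contrapT => h; apply: Nw; apply: goodN.
pose D n := if pickle_inv n is Some j then labelled j else set0.
have mD n : measurable (D n).
  rewrite /D; case: pickle_inv => [j|]; last exact: measurable0.
  exact: (sigma_measurable (sigma_labelled j)).
have mGv i : measurable_fun setT (fun w => vertex_in (B i) (G w)).
  apply: (measurableT_comp (f := vertex_in (B i))); first exact: measurable_vertex_in.
  exact: measurable_funPT.
have mS : measurable (G @^-1` pattern_event a b A E).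
  by apply: measurable_funPTI; exact: measurable_pattern_event.
have mC : measurable (G @^-1` cell_event a b A).
  by apply: measurable_funPTI; exact: measurable_cell_event.
have mf : measurable_fun setT (fun w => (F (box_vertices a b (G w)))%:E).
  by apply/measurable_EFinP; exact: (mF _ _ (fun i w => vertex_in (B i) (G w))).
have cover w : (G @^-1` cell_event a b A `\` N) w -> (\bigcup_n D n) w.
  move=> [[s _] /good gw]; have [j hj] := single_labelled gw s.
  by exists (choice.pickle j) => //; rewrite /D choice.pickleK_inv.
apply: (measure_integral_partition (N := N) (D := D)) => //.
- move=> m n _ _ [w []]; rewrite /D.
  have := @choice.pickle_invK {ffun J -> nat} m; have := @choice.pickle_invK {ffun J -> nat} n.
  case: (pickle_inv m) => [j|//]; case: (pickle_inv n) => [j'|//] /= <- <- h h'.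
  by rewrite (labelled_uniq h h').
- by move=> w [[h _] Nw]; exact: cover.
- by move=> w; rewrite lee_fin.
move=> n; rewrite /D; case: pickle_inv => [j|]; last first.
  by rewrite !setI0 measure0 integral_set0.
have [[w0 lw0]|none] := pselect (exists w, labelled j w); last first.
  have -> : labelled j = set0 by apply/seteqP; split => // w lw; apply: none; exists w.
  by rewrite !setI0 measure0 integral_set0.
have ij := labelled_inj lw0.
have [mE EE] := hE (fun i => j i) ij.
have sSj : sigma_of X (labelled j `&` [set w | A (fun i => X (j i) w)]).
  pose W := g_sigma_algebraType (\bigcup_i g_sigma_algebra_preimage (X i)).
  suff : @measurable _ W (labelled j `&` [set w | A (fun i => X (j i) w)]) by [].
  apply: measurableI; first exact: sigma_labelled.
  apply: (mA _ W (fun i w => X (j i) w)) => i _ C mC'; rewrite setTI; exact: sigmaX.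
have mj := sigma_measurable (sigma_labelled j).
have mSj := sigma_measurable sSj.
rewrite (@measure_eq_off_null _ _ _ P N _ (labelled j `&` [set w | A (fun i => X (j i) w)]
   `&` [set w | has_edges E (fun i => X (j i) w) (G w)]))//; last 3 first.
- exact: measurableI.
- exact: measurableI.
- apply/seteqP; split => w.
    move=> [[[[s Aw] h] lw] Nw]; have [_ yE] := labelled_vertices (good _ Nw) lw.
    by rewrite /= -yE; split.
  move=> [[[lw Aw] h] Nw]; have [s yE] := labelled_vertices (good _ Nw) lw.
  by split => //; split => //; split; [split|]; rewrite //= yE.
rewrite [LHS](EE _ sSj).
apply: (integral_eq_off_null (N := N)) => //.
- exact: measurableI.
- by apply/measurable_EFinP; exact: (mF _ _ (fun i w => X (j i) w)).
- by move=> w; rewrite lee_fin.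
- by move=> w; rewrite lee_fin.
- apply/seteqP; split => w.
    move=> [[lw Aw] Nw]; have [s yE] := labelled_vertices (good _ Nw) lw.
    by split => //; split => //; split; rewrite //= yE.
  move=> [[[s Aw] lw] Nw]; have [_ yE] := labelled_vertices (good _ Nw) lw.
  by rewrite /= -yE; split.
- by move=> w [lw Aw] Nw; have [_ ->] := labelled_vertices (good _ Nw) lw.
Qed.

End edge_formula.

Lemma ge0_integral_mrestr d (T : measurableType d) (R : realType)
    (mu : {measure set T -> \bar R}) (D : set T) (mD : measurable D) (f : T -> \bar R) :
  measurable_fun setT f -> (forall x, (0 <= f x)%E) ->
  (\int[mrestr mu mD]_x f x = \int[mu]_(x in D) f x)%E.
Proof.
move=> mf f0; have mCD : measurable (~` D) by exact: measurableC.
have N0 : mrestr mu mD (~` D) = 0%E by rewrite /mrestr setICl measure0.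
rewrite [LHS](ge0_negligible_integral mCD measurableT mf (fun x _ => f0 x) N0).
rewrite setTD setCK; apply: eq_measure_integral => A mA AD.
by rewrite /= /mrestr setIidl.
Qed.

(** A statistic of a sigma-algebra independent of the event A integrates over A as if
A only scaled the measure: compare the laws of the statistic. *)
Lemma integral_independent_event d (T : measurableType d) (R : realType)
    (P : probability T R) (FF : set (set T)) (A B : set T) (c : R) (f : T -> R) :
  0 <= c -> measurable A -> measurable B ->
  (forall C, FF C -> P (C `&` A) = (c%:E * P C)%E) ->
  (forall Y, measurable Y -> FF (B `&` f @^-1` Y)) ->
  measurable_fun setT f -> (forall x, 0 <= f x) ->
  (\int[P]_(w in B `&` A) (f w)%:E = c%:E * \int[P]_(w in B) (f w)%:E)%E.
Proof.
move=> c0 mA mB indep fF mf f0.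
have mBA : measurable (B `&` A) by exact: measurableI.
pose nn (y : R) : \bar R := (Num.max y 0)%:E.
have mnn : measurable_fun [set: R] nn.
  by apply/measurable_EFinP; apply: measurable_maxr => //; exact: measurable_cst.
have nn0 y : (0 <= nn y)%E by rewrite lee_fin le_max lexx orbT.
have H (D : set T) (mD : measurable D) :
    (\int[P]_(w in D) (f w)%:E = \int[pushforward (mrestr P mD) f]_y nn y)%E.
  rewrite ge0_integral_pushforward//.
  rewrite preimage_setT ge0_integral_mrestr//.
  - by apply: eq_integral => w _; rewrite /nn /= max_l.
  - exact: measurableT_comp.
  - by move=> w; exact: nn0.
pose mu1 := measure_function_pushforward__canonical__measure_function_Measure
  (measure_function_mrestr__canonical__measure_function_Measure P mBA) mf.
pose mu2 := measure_function_pushforward__canonical__measure_function_Measure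
  (measure_function_mrestr__canonical__measure_function_Measure P mB) mf.
rewrite (H _ mBA) (H _ mB) -[c]/((NngNum c0)%:num).
rewrite -(@ge0_integral_mscale _ _ _ mu2)//.
apply: (@eq_measure_integral _ _ _ _ _ mu1) => Y mY _.
rewrite /= /mscale /= /pushforward /mrestr.
rewrite (_ : f @^-1` Y `&` (B `&` A) = (B `&` f @^-1` Y) `&` A); last first.
  by rewrite setIA [_ `&` B]setIC.
by rewrite indep; [rewrite setIC|exact: fF].
Qed.

Lemma measurable_radial (R : realType) (d : nat) (f : R -> R) :
  measurable_fun (`[(0 : R), +oo[ : set R) f ->
  measurable_fun [set: 'rV[R]_d] (fun x => f (enorm x)).
Proof.
move=> mf; apply: (measurable_comp (F := `[(0 : R), +oo[%classic)) => //.
- by move=> _ [x _ <-]; rewrite /= in_itv/= andbT enorm_ge0.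
- exact: measurable_enorm.
Qed.

Lemma measurable_rowvec_sub (R : realType) (d : nat) dW (W : measurableType dW)
    (Y1 Y2 : W -> 'rV[R]_d) :
  measurable_fun setT Y1 -> measurable_fun setT Y2 ->
  measurable_fun setT (fun w => Y1 w - Y2 w).
Proof.
move=> m1 m2; apply: measurable_fun_rowvecP => i; under eq_fun do rewrite !mxE.
by apply: measurable_funB; apply: (measurableT_comp (measurable_coord i)).
Qed.

Lemma measurable_pair_statistic (R : realType) (d : nat) (J : finType)
    (E : seq (J * J)) (f : J * J -> R -> R) :
  (forall p, measurable_fun (`[(0 : R), +oo[ : set R) (f p)) ->
  measurable_statistic (fun x : J -> 'rV[R]_d => \prod_(p <- E) f p (enorm (x p.1 - x p.2))).
Proof.
move=> mf dW W Y mY; apply: measurable_prod => p _.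
apply: (measurableT_comp (measurable_radial (mf p))).
exact: measurable_rowvec_sub.
Qed.

Definition simple_pattern (J : finType) (E : seq (J * J)) : bool :=
  [&& uniq E, all (fun p => p.1 != p.2) E & all (fun p => (p.2, p.1) \notin E) E].

Section edge_laws.
Context (R : realType) (dO : measure_display) (Omega : measurableType dO).
Variables (P : probability Omega R) (d : nat).
Variables (G : {mfun Omega >-> spatial_graph R d}) (X : nat -> {mfun Omega >-> 'rV[R]_d}).
Variable J : finType.
Implicit Types (E : seq (J * J)) (j : J -> nat).

Definition ordered j (p : J * J) : nat * nat :=
  if (j p.1 < j p.2)%N then (j p.1, j p.2) else (j p.2, j p.1).

Let ordered_inj E j : simple_pattern E -> injective j -> {in E &, injective (ordered j)}.
Proof.
move=> /and3P[_ _ /allP asym] ij [x y] [x' y'] pE qE; rewrite /ordered /=.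
case: ifP => _; case: ifP => _ [] /ij e1 /ij e2; subst => //.
- by have := asym _ pE; rewrite /= qE.
- by have := asym _ pE; rewrite /= qE.
Qed.

Let ordered_pair E j p : simple_pattern E -> injective j -> p \in E ->
  index_pairs (ordered j p).
Proof.
move=> /and3P[_ /allP irr _] ij pE; rewrite /index_pairs /ordered /=.
case: ifP => //= /negbT; rewrite -leqNgt leq_eqVlt => /orP[/eqP /ij e|//].
by have := irr _ pE; rewrite e eqxx.
Qed.

(** Conditional independence for the pairs of indices realizing a pattern; the
undirected edges are listed once, in increasing order of indices. *)
Lemma cond_independent_pattern FF (pi : nat * nat -> Omega -> R) E j :
  simple_pattern E -> injective j ->
  cond_independent_events P FF index_pairs (edge_event G X) pi ->
  measurable [set w | has_edges E (fun i => X (j i) w) (G w)] /\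
  forall B, FF B ->
    P (B `&` [set w | has_edges E (fun i => X (j i) w) (G w)]) =
    (\int[P]_(w in B) (\prod_(p <- E) pi (ordered j p) w)%:E)%E.
Proof.
move=> sE ij [mpi hpi].
pose K := [fset q | q in map (ordered j) E]%fset.
have KE q : (q \in K) = (q \in map (ordered j) E) by rewrite !inE.
have EK : [set w | has_edges E (fun i => X (j i) w) (G w)] =
    \bigcap_(q in [set` K]) edge_event G X q.
  apply/seteqP; split => w /= h.
    move=> q /=; rewrite KE => /mapP[p pE ->]; rewrite /edge_event /ordered /=.
    by case: ifP => _ /=; [exact: h|apply: edges_sym; exact: h].
  move=> p pE; have : [set` K] (ordered j p) by rewrite /= KE map_f.
  by move=> /h; rewrite /edge_event /ordered /=; case: ifP => _ //= /edges_sym.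
have KI : [set` K] `<=` index_pairs.
  by move=> q /=; rewrite KE => /mapP[p pE ->]; exact: (ordered_pair sE).
split.
  rewrite EK; apply: fin_bigcap_measurable => // q qK; exact/mpi/KI.
move=> B FB; rewrite EK.
have := hpi K (fun=> true) B KI FB; rewrite /= => ->.
apply: eq_integral => w _; congr EFin.
rewrite -(big_map (ordered j) xpredT (fun q => pi q w)).
apply: perm_big; apply: uniq_perm; [exact: fset_uniq| |exact: KE].
by rewrite map_inj_in_uniq; [case/and3P: sE|exact: ordered_inj].
Qed.

Definition rcm_statistic (g : R -> R) E (x : J -> 'rV[R]_d) : R :=
  \prod_(p <- E) g (enorm (x p.1 - x p.2)).

Lemma rcm_edge_law (g : R -> R) E : simple_pattern E ->
  cond_independent_events P (sigma_of X) index_pairs (edge_event G X)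
    (fun ij w => g (enorm (X ij.1 w - X ij.2 w))) ->
  edge_law P G X E (rcm_statistic g E).
Proof.
move=> sE ci j ij; have [mE hE] := cond_independent_pattern sE ij ci.
split; first exact: mE.
move=> B sB; apply: etrans (hE B sB) _; apply: eq_integral => w _; congr EFin.
apply: eq_bigr => p _; rewrite /ordered; case: ifP => _ //=.
by rewrite enorm_subC.
Qed.

(** The signs are indexed by a finite type listing every assignment once, so that
the average over the signs of two separate cells splits as a product. *)
Variables (S : finType) (sgn : S -> J -> bool).
Hypothesis sgn_surj : forall f : J -> bool, exists z, sgn z =1 f.
Hypothesis sgn_inj : forall z z', sgn z =1 sgn z' -> z = z'.

Definition signed_statistic (fin fout : R -> R) E (z : S) (x : J -> 'rV[R]_d) : R :=
  \prod_(p <- E) let r := enorm (x p.1 - x p.2) in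
    if sgn z p.1 == sgn z p.2 then fin r else fout r.

Definition planted_statistic (fin fout : R -> R) E (x : J -> 'rV[R]_d) : R :=
  2^-1 ^+ #|J| * \sum_(z : S) signed_statistic fin fout E z x.

Section planted.
Variable Z : nat -> {mfun Omega >-> R}.
Hypothesis hZ : forall i, uniform_sign P (Z i).
Hypothesis indep : mutually_independent P (fun o : option nat =>
        if o is Some i then g_sigma_algebra_preimage (Z i) else sigma_of X).

Let sign (b : bool) : R := if b then 1 else -1.

Let sign_event j z := \bigcap_(i in [set: J]) (Z (j i) @^-1` [set sign (sgn z i)]).

Let measurable_sign_event j z : measurable (sign_event j z).
Proof.
exact: fin_bigcap_measurable.
Qed.

Let sign_inj : injective sign.
Proof. by move=> [] [] //=; rewrite /sign => h; exfalso; move: h; lra. Qed.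

Let prob_sign i b : P (Z i @^-1` [set sign b]) = (2^-1)%:E.
Proof. by have [h1 h2] := hZ i; case: b. Qed.

Let independent_signs j z B : injective j -> sigma_of X B ->
  P (B `&` sign_event j z) = ((2^-1 ^+ #|J|)%:E * P B)%E.
Proof.
move=> ij sB.
pose s n := [exists i, (j i == n) && sgn z i].
have sE i : s (j i) = sgn z i.
  apply/existsP/idP => [[i' /andP[/eqP /ij -> //]]|si].
  by exists i; rewrite eqxx.
pose E (o : option nat) := if o is Some n then Z n @^-1` [set sign (s n)] else B.
pose K := (None |` [fset Some (j i) | i in J])%fset.
have := indep (J := K) (E := E).
rewrite (_ : \bigcap_(i in [set` K]) E i = B `&` sign_event j z); last first.
  apply/seteqP; split => w h.
    split; first by have := h None; rewrite /= !inE eqxx; apply.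
    move=> i _; have := h (Some (j i)); rewrite /= sE; apply.
    by rewrite !inE /=; apply/imfsetP; exists i.
  case: h => Bw h [n|//]; rewrite /= !inE /= => /imfsetP[i _ [->]].
  by rewrite /= sE; exact: h.
move=> -> => [|[n|] _ //=]; last first.
  by exists [set sign (s n)]; [exact: measurable_set1|rewrite setTI].
rewrite big_fsetU1/=; last by apply/imfsetP => -[i _].
rewrite muleC; congr (_ * _)%E.
rewrite big_imfset/=; last by move=> i i' _ _ [] /ij.
rewrite (eq_bigr (fun=> (2^-1)%:E)); last by move=> i _; exact: prob_sign.
by rewrite prodEFin big_const_seq/= count_predT -Monoid.iteropE /= -cardE.
Qed.

Let sign_partition j A : measurable A ->
  P A = (\sum_(z : S) P (A `&` sign_event j z))%E.
Proof.
move=> mA.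
pose N := \bigcup_n ~` (Z n @^-1` [set sign true] `|` Z n @^-1` [set sign false]).
have mZ n b : measurable (Z n @^-1` [set sign b]).
  exact: (measurable_funPTI (Z n) (measurable_set1 (sign b))).
have mN n : measurable (~` (Z n @^-1` [set sign true] `|` Z n @^-1` [set sign false])).
  by apply: measurableC; exact: measurableU.
have N0 : P N = 0%E.
  apply/negligibleP; first exact: bigcupT_measurable.
  apply: negligible_bigcup => n; apply/negligibleP; first exact: mN.
  rewrite [LHS]probability_setC; last exact: measurableU.
  rewrite measureU//; last first.
    apply/seteqP; split => // w [/= e1 e2].
    by have := @sign_inj true false (etrans (esym e1) e2).
  rewrite [X in (_ - (X + _))%E](prob_sign n true).
  rewrite [X in (_ - (_ + X))%E](prob_sign n false) -EFinD.
  have -> : 2^-1 + 2^-1 = 1 :> R by lra.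
  by rewrite subrr.
rewrite (@measure_eq_off_null _ _ _ P N A (\bigcup_(z in [set: S]) (A `&` sign_event j z)))//.
- rewrite measure_fin_bigcup//.
  + rewrite [RHS]bigfs ?index_enum_uniq// => [|z _]; last by rewrite mem_index_enum.
    by rewrite (_ : [set` _] = setT)//; apply/seteqP; split.
  + exact: finite_finset.
  + move=> z z' _ _ [w [[_ h] [_ h']]]; apply: sgn_inj => i; apply: sign_inj.
    by rewrite -(h i I) -(h' i I).
  + by move=> z _; apply: measurableI => //; exact: measurable_sign_event.
- exact: bigcupT_measurable.
- by apply: fin_bigcup_measurable => // z _; apply: measurableI => //; exact: measurable_sign_event.
- apply/seteqP; split => w [Aw Nw]; last by case: Aw => z _ [].
  split => //.
  have [z hz] := sgn_surj (fun i => Z (j i) w == 1).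
  exists z => //; split => // i _ /=; rewrite hz.
  have : (Z (j i) @^-1` [set sign true] `|` Z (j i) @^-1` [set sign false]) w.
    by apply: contrapT => h; apply: Nw; exists (j i).
  case=> /= ->; first by rewrite eqxx.
  by case: eqP => // h; have := @sign_inj false true h.
Qed.

(** Condition on the signs as well; they are independent of the locations, so each of
the equally likely assignments contributes its own product of connection
probabilities. *)
Lemma planted_edge_law (fin fout : R -> R) E : simple_pattern E ->
  measurable_fun (`[(0 : R), +oo[ : set R) fin ->
  measurable_fun (`[(0 : R), +oo[ : set R) fout ->
  (forall r, 0 <= r -> 0 <= fin r) -> (forall r, 0 <= r -> 0 <= fout r) ->
  cond_independent_events P (<<s sigma_of X `|` sigma_of Z >>) index_pairs
    (edge_event G X)
    (fun ij w => let r := enorm (X ij.1 w - X ij.2 w) in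
       if Z ij.1 w == Z ij.2 w then fin r else fout r) ->
  edge_law P G X E (planted_statistic fin fout E).
Proof.
move=> sE mfin mfout fin0 fout0 ci j ij.
have [mE hE] := cond_independent_pattern sE ij ci; split => // B sB.
have mB : measurable B.
  move: B sB; apply: smallest_sub; first exact: sigma_algebra_measurable.
  by move=> _ [n _ [D mD <-]]; exact: measurable_funPT.
pose W := g_sigma_algebraType (\bigcup_i g_sigma_algebra_preimage (X i)).
pose phi z w := signed_statistic fin fout E z (fun i => X (j i) w).
have phi0 z w : 0 <= phi z w.
  apply: prodr_ge0 => p _ /=; case: ifP => _; [apply: fin0|apply: fout0]; exact: enorm_ge0.
have mstat z : measurable_statistic (signed_statistic fin fout E z).
  apply: (@measurable_pair_statistic R d J E
    (fun p r => if sgn z p.1 == sgn z p.2 then fin r else fout r)) => p.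
  by case: eqP.
have mphiW z : measurable_fun [set: W] (phi z).
  apply: (mstat z _ W (fun i w => X (j i) w)) => i _ C mC; rewrite setTI.
  by apply: sub_sigma_algebra; exists (j i) => //; exists C; rewrite ?setTI.
have mphi z : measurable_fun setT (phi z).
  exact: (mstat z _ Omega (fun i w => X (j i) w)).
have c0 : 0 <= 2^-1 ^+ #|J| :> R by rewrite exprn_ge0// invr_ge0.
rewrite (sign_partition j); last exact: measurableI.
transitivity (\sum_(z : S) (2^-1 ^+ #|J|)%:E * \int[P]_(w in B) (phi z w)%:E)%E.
  apply: eq_bigr => z _.
  have sBz : <<s sigma_of X `|` sigma_of Z >> (B `&` sign_event j z).
    pose W2 := g_sigma_algebraType (sigma_of X `|` sigma_of Z).
    suff : @measurable _ W2 (B `&` sign_event j z) by [].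
    apply: measurableI; first by apply: sub_sigma_algebra; left.
    apply: fin_bigcap_measurable => // i _; apply: sub_sigma_algebra; right.
    apply: sub_sigma_algebra; exists (j i) => //.
    by exists [set sign (sgn z i)]; [exact: measurable_set1|rewrite setTI].
  have sphi Y : measurable Y -> sigma_of X (B `&` phi z @^-1` Y).
    move=> mY; suff : @measurable _ W (B `&` phi z @^-1` Y) by [].
    by apply: measurableI => //; rewrite -[X in measurable X]setTI; exact: mphiW.
  rewrite setIAC; apply: etrans (hE _ sBz) _.
  apply: etrans (integral_independent_event c0 (measurable_sign_event j z) mB
    (fun C => independent_signs z ij (B := C)) sphi (mphi z) (phi0 z)).
  apply: eq_integral => w; rewrite inE => -[_ h]; congr EFin.
  apply: eq_bigr => p _ /=.
  have sw i i' : (Z (j i) w == Z (j i') w) = (sgn z i == sgn z i').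
    by rewrite (h i I) (h i' I) (inj_eq sign_inj).
  rewrite /ordered; case: (j p.1 < j p.2)%N => /=; first by rewrite sw.
  by rewrite sw eq_sym enorm_subC.
under eq_bigr => z _.
  rewrite -ge0_integralZl//; last 2 first.
  - by apply/measurable_EFinP; exact: measurable_funTS.
  - by move=> w _; rewrite lee_fin.
  over.
rewrite -ge0_integral_sum//; last 2 first.
- move=> z; apply/measurable_EFinP; apply: measurable_funM => //.
  exact: measurable_funTS.
- by move=> z w _; rewrite -EFinM lee_fin mulr_ge0.
apply: eq_integral => w _; rewrite /planted_statistic mulr_sumr -sumEFin.
by apply: eq_bigr.
Qed.

End planted.
End edge_laws.

(** * Measures on products *)

(** Uniqueness of finite measures, as a property of the family of test sets that passes
to products one factor at a time. *)
Definition determining (R : realType) d (T : measurableType d) (C : set (set T)) : Prop :=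
  forall m1 m2 : {measure set T -> \bar R},
    (m1 setT < +oo)%E -> (m2 setT < +oo)%E ->
    (forall A, C A -> m1 A = m2 A) -> forall A, measurable A -> m1 A = m2 A.

Definition rectangles T1 T2 (C1 : set (set T1)) (C2 : set (set T2)) : set (set (T1 * T2)) :=
  [set A | exists2 A1, C1 A1 & exists2 A2, C2 A2 & A = A1 `*` A2].

(** With one side of a rectangle fixed, both measures are finite measures in the other
side. *)
Lemma determining_rectangles (R : realType) d1 d2 (T1 : measurableType d1)
    (T2 : measurableType d2) (C1 : set (set T1)) (C2 : set (set T2)) :
  C2 `<=` measurable -> determining R C1 -> determining R C2 ->
  determining R (rectangles C1 C2).
Proof.
move=> mC2 D1 D2 m1 m2 f1 f2 m12.
have mX (A1 : set T1) (A2 : set T2) : measurable A1 -> measurable A2 ->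
    measurable (A1 `*` A2) by exact: measurableX.
have fin (m : {measure set (T1 * T2) -> \bar R}) A : (m setT < +oo)%E ->
    measurable A -> (m A < +oo)%E.
  by move=> fm mA; apply: le_lt_trans fm; apply: le_measure; rewrite ?inE.
have step1 A1 A2 : measurable A1 -> C2 A2 -> m1 (A1 `*` A2) = m2 (A1 `*` A2).
  move=> mA1 cA2; have mA2 := mC2 _ cA2.
  have mS := mX setT A2 measurableT mA2.
  pose n1 := measure_function_pushforward__canonical__measure_function_Measure
    (measure_function_mrestr__canonical__measure_function_Measure m1 mS)
    (@measurable_fst _ _ T1 T2).
  pose n2 := measure_function_pushforward__canonical__measure_function_Measure
    (measure_function_mrestr__canonical__measure_function_Measure m2 mS)
    (@measurable_fst _ _ T1 T2).
  have nE (m : {measure set (T1 * T2) -> \bar R}) A :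
      pushforward (mrestr m mS) fst A = m (A `*` A2).
    rewrite /pushforward /mrestr; congr (m _).
    by apply/seteqP; split => -[x y] /=; tauto.
  rewrite -!nE; apply: (D1 n1 n2) => //=.
  - by rewrite nE; apply: fin f1 _; exact: mX.
  - by rewrite nE; apply: fin f2 _; exact: mX.
  - by move=> A cA; rewrite !nE; apply: m12; exists A => //; exists A2.
have step2 A1 A2 : measurable A1 -> measurable A2 -> m1 (A1 `*` A2) = m2 (A1 `*` A2).
  move=> mA1 mA2.
  have mS := mX A1 setT mA1 measurableT.
  pose n1 := measure_function_pushforward__canonical__measure_function_Measure
    (measure_function_mrestr__canonical__measure_function_Measure m1 mS)
    (@measurable_snd _ _ T1 T2).
  pose n2 := measure_function_pushforward__canonical__measure_function_Measure
    (measure_function_mrestr__canonical__measure_function_Measure m2 mS)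
    (@measurable_snd _ _ T1 T2).
  have nE (m : {measure set (T1 * T2) -> \bar R}) A :
      pushforward (mrestr m mS) snd A = m (A1 `*` A).
    rewrite /pushforward /mrestr; congr (m _).
    by apply/seteqP; split => -[x y] /=; tauto.
  rewrite -!nE; apply: (D2 n1 n2) => //=.
  - by rewrite nE; apply: fin f1 _; exact: mX.
  - by rewrite nE; apply: fin f2 _; exact: mX.
  - by move=> A cA; rewrite !nE; exact: step1.
apply: (measure_unique (rectangles measurable measurable) (fun=> setT)) => //.
- rewrite measurable_prod_measurableType; congr (<<s _ >>).
  apply/seteqP; split => A /=.
    by move=> [A1 mA1 [A2 mA2 <-]]; exists A1 => //; exists A2.
  by move=> [A1 mA1 [A2 mA2 ->]]; exists A1 => //; exists A2.
- move=> _ _ [A1 mA1 [A2 mA2 ->]] [B1 mB1 [B2 mB2 ->]].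
  exists (A1 `&` B1); first exact: measurableI.
  by exists (A2 `&` B2); [exact: measurableI|rewrite setXI].
- by move=> _; exists setT => //; exists setT => //; rewrite setXTT.
- by rewrite bigcup_const//; exists 0%N.
- by move=> _ [A1 mA1 [A2 mA2 ->]]; exact: step2.
Qed.

Lemma determining_measurable (R : realType) d (T : measurableType d) :
  determining R (@measurable _ T).
Proof. by move=> m1 m2 _ _. Qed.

Lemma rectangles_measurable d1 d2 (T1 : measurableType d1) (T2 : measurableType d2)
    (C1 : set (set T1)) (C2 : set (set T2)) :
  C1 `<=` measurable -> C2 `<=` measurable -> rectangles C1 C2 `<=` measurable.
Proof.
by move=> m1 m2 _ [A1 /m1 ? [A2 /m2 ? ->]]; exact: measurableX.
Qed.

Lemma ge0_integral_mrestr_setI d (T : measurableType d) (R : realType)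
    (mu : {measure set T -> \bar R}) (D : set T) (mD : measurable D) (C : set T)
    (f : T -> \bar R) :
  measurable C -> measurable_fun setT f -> (forall x, (0 <= f x)%E) ->
  (\int[mrestr mu mD]_(x in C) f x = \int[mu]_(x in D `&` C) f x)%E.
Proof.
move=> mC mf f0; rewrite [LHS]integral_mkcond [LHS]ge0_integral_mrestr.
- by rewrite integral_mkcondr.
- by apply/(measurable_restrictT f mC); exact: measurable_funTS.
- by move=> x; rewrite patchE; case: ifP.
Qed.

Lemma integral_product_split d1 d2 (T1 : measurableType d1) (T2 : measurableType d2)
    (R : realType) (m1 : {sigma_finite_measure set T1 -> \bar R})
    (m2 : {sigma_finite_measure set T2 -> \bar R}) (C1 : set T1) (C2 : set T2)
    (f : T1 -> R) (g : T2 -> R) :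
  measurable C1 -> measurable C2 -> measurable_fun setT f -> measurable_fun setT g ->
  (forall x, 0 <= f x) -> (forall x, 0 <= g x) ->
  (\int[m1 \x m2]_(z in C1 `*` C2) (f z.1 * g z.2)%:E =
   \int[m1]_(x in C1) (f x)%:E * \int[m2]_(y in C2) (g y)%:E)%E.
Proof.
move=> mC1 mC2 mf mg f0 g0.
pose f' := (EFin \o f) \_ C1; pose g' := (EFin \o g) \_ C2.
have mf' : measurable_fun setT f'.
  apply/(measurable_restrictT _ mC1); apply: measurable_funTS; exact/measurable_EFinP.
have mg' : measurable_fun setT g'.
  apply/(measurable_restrictT _ mC2); apply: measurable_funTS; exact/measurable_EFinP.
have f'0 x : (0 <= f' x)%E by rewrite /f' patchE; case: ifP => //; rewrite lee_fin.
have g'0 x : (0 <= g' x)%E by rewrite /g' patchE; case: ifP => //; rewrite lee_fin.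
rewrite integral_mkcond.
transitivity (\int[m1 \x m2]_z (f' z.1 * g' z.2))%E.
  apply: eq_integral => -[x y] _ /=; rewrite /f' /g' !patchE in_setX /=.
  by case: (x \in C1); case: (y \in C2); rewrite /= ?EFinM ?mule0 ?mul0e.
rewrite fubini_tonelli1; last 2 first.
- apply: emeasurable_funM; apply: measurableT_comp => //.
- by move=> z; exact: mule_ge0.
rewrite [X in (X * _)%E]integral_mkcond [X in (_ * X)%E]integral_mkcond -/f' -/g'.
rewrite /fubini_F /=.
under eq_integral do rewrite ge0_integralZl//.
by rewrite ge0_integralZr//; exact: integral_ge0.
Qed.

(** * Cells of four boxes *)

(** The index (s, k) is the k-th of two points on side s: the pattern used below is
the complete bipartite graph between the two sides. *)
Notation quad A := ((A * A) * (A * A))%type.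

Definition quad_coord A (t : quad A) (i : bool * bool) : A :=
  if i.1 then (if i.2 then t.2.2 else t.2.1) else (if i.2 then t.1.2 else t.1.1).

Definition mkquad A (x : bool * bool -> A) : quad A :=
  ((x (false, false), x (false, true)), (x (true, false), x (true, true))).

Lemma mkquadK A (x : bool * bool -> A) : quad_coord (mkquad x) = x.
Proof. by apply/funext => -[[] []]. Qed.

Lemma quad_coordK A (t : quad A) : mkquad (quad_coord t) = t.
Proof. by case: t => -[? ?] [? ?]. Qed.

Lemma big_bool2 (A : Type) (idx : A) (op : Monoid.com_law idx) (F : bool * bool -> A) :
  \big[op/idx]_i F i =
  op (op (F (false, false)) (F (false, true))) (op (F (true, false)) (F (true, true))).
Proof.
rewrite (eq_bigr (fun p => F (p.1, p.2))); last by case.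
rewrite -(pair_bigA _ (fun i j => F (i, j)))/= big_bool !big_bool Monoid.mulmC.
by congr (op _ _); exact: Monoid.mulmC.
Qed.

Section quad_measurable.
Context (R : realType) (d : nat).
Local Notation V := 'rV[R]_d.

Definition quad_rectangles : set (set (quad V)) :=
  rectangles (rectangles measurable measurable) (rectangles measurable measurable).

Lemma quad_rectangles_measurable : quad_rectangles `<=` measurable.
Proof. by apply: rectangles_measurable; apply: rectangles_measurable. Qed.

Lemma determining_quad : determining R quad_rectangles.
Proof.
by apply: determining_rectangles;
  [apply: rectangles_measurable|apply: determining_rectangles|apply: determining_rectangles];
  try exact: determining_measurable.
Qed.

Lemma measurable_mkquad dW (W : measurableType dW) (Y : bool * bool -> W -> V) :
  (forall i, measurable_fun setT (Y i)) ->
  measurable_fun setT (fun w => mkquad (fun i => Y i w)).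
Proof. by move=> mY; do !apply: measurable_fun_pair. Qed.

Lemma measurable_quad_coord i : measurable_fun [set: quad V] (fun t => quad_coord t i).
Proof.
case: i => -[] [] /=; rewrite /quad_coord /=;
  by [apply: (measurableT_comp measurable_snd); exact: measurable_snd|
      apply: (measurableT_comp measurable_fst); exact: measurable_snd|
      apply: (measurableT_comp measurable_snd); exact: measurable_fst|
      apply: (measurableT_comp measurable_fst); exact: measurable_fst].
Qed.

Variables (lambda : R) (a b : bool * bool -> V).

Definition side_law (s : bool) : set (V * V)%type -> \bar R :=
  (point_law lambda (a (s, false)) (b (s, false)) \x
   point_law lambda (a (s, true)) (b (s, true)))%E.
HB.instance Definition _ s := Measure.on (side_law s).

Lemma side_law_rectangle s (C1 C2 : set V) : measurable C1 -> measurable C2 ->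
  side_law s (C1 `*` C2) = (point_law lambda (a (s, false)) (b (s, false)) C1 *
    point_law lambda (a (s, true)) (b (s, true)) C2)%E.
Proof. by move=> m1 m2; rewrite /side_law product_measure1E. Qed.

Lemma side_law_fin s : fin_num_fun (side_law s).
Proof.
move=> C mC; rewrite ge0_fin_numE//.
apply: (@le_lt_trans _ _ (side_law s setT)); first by apply: le_measure; rewrite ?inE.
by rewrite -setXTT side_law_rectangle// lte_mul_pinfty// ?point_law_fin// -ge0_fin_numE// point_law_fin.
Qed.
HB.instance Definition _ s := Measure_isFinite.Build _ _ _ (side_law s) (side_law_fin s).

(** Joint law of the unique vertices in the four boxes of a cell. *)
Definition cell_law : set (quad V) -> \bar R := (side_law false \x side_law true)%E.
HB.instance Definition _ := Measure.on cell_law.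

Lemma cell_law_rectangle (C : bool * bool -> set V) :
  (forall i, measurable (C i)) ->
  cell_law ((C (false, false) `*` C (false, true)) `*` (C (true, false) `*` C (true, true)))
  = (\prod_i point_law lambda (a i) (b i) (C i))%E.
Proof.
move=> mC; rewrite big_bool2 /cell_law /=.
rewrite product_measure1E; [|exact: measurableX|exact: measurableX].
by congr (_ * _)%E; exact: side_law_rectangle.
Qed.

Lemma cell_law_fin : fin_num_fun cell_law.
Proof.
move=> C mC; rewrite ge0_fin_numE//.
apply: (@le_lt_trans _ _ (cell_law setT)); first by apply: le_measure; rewrite ?inE.
rewrite -setXTT /cell_law product_measure1E// lte_mul_pinfty// ?side_law_fin//.
by rewrite -ge0_fin_numE// side_law_fin.
Qed.
HB.instance Definition _ := Measure_isFinite.Build _ _ _ cell_law cell_law_fin.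
End quad_measurable.

Lemma measurable_quad_statistic (R : realType) (d : nat)
    (F : (bool * bool -> 'rV[R]_d) -> R) :
  measurable_statistic F -> measurable_fun [set: quad 'rV[R]_d] (fun t => F (quad_coord t)).
Proof.
by move=> mF; apply: (mF _ _ (fun i t => quad_coord t i)) => i; exact: measurable_quad_coord.
Qed.

Section configuration_law.
Context (R : realType) (dO : measure_display) (Omega : measurableType dO).
Variables (P : probability Omega R) (d : nat).
Variables (G : {mfun Omega >-> spatial_graph R d}).
Context (J : finType) dT (T : measurableType dT).
Variables (q : (J -> 'rV[R]_d) -> T) (a b : J -> 'rV[R]_d).
Hypothesis mq : forall dW (W : measurableType dW) (Y : J -> W -> 'rV[R]_d),
  (forall i, measurable_fun setT (Y i)) -> measurable_fun setT (fun w => q (fun i => Y i w)).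

Lemma measurable_config_preimage (C : set T) : measurable C ->
  measurable_config [set x | C (q x)].
Proof.
move=> mC dW W Y mY; rewrite -[X in measurable X]setTI.
exact: (mq mY measurableT mC).
Qed.

Let mE : measurable (G @^-1` all_single a b).
Proof.
apply: measurable_funPTI; apply: fin_bigcap_measurable => // i _.
exact: measurable_single_vertex_box.
Qed.

Let Y (w : Omega) : T := q (box_vertices a b (G w)).

Let mY : measurable_fun setT Y.
Proof.
apply: (mq (Y := fun i w => vertex_in (box (a i) (b i)) (G w))) => i.
apply: (measurableT_comp (measurable_vertex_in (a i) (b i))).
exact: measurable_funPT.
Qed.

Let law := measure_function_pushforward__canonical__measure_function_Measure
  (measure_function_mrestr__canonical__measure_function_Measure P mE) mY.

Let lawE C : law C = P (G @^-1` cell_event a b [set x | C (q x)]).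
Proof. by rewrite /= /pushforward /mrestr setIC. Qed.

Lemma configuration_law_determined (CC : set (set T)) (nu : {measure set T -> \bar R}) :
  determining R CC -> (nu setT < +oo)%E ->
  (forall C, CC C -> P (G @^-1` cell_event a b [set x | C (q x)]) = nu C) ->
  forall C, measurable C -> P (G @^-1` cell_event a b [set x | C (q x)]) = nu C.
Proof.
move=> dC fnu h C mC; rewrite -lawE; apply: (dC law nu) => //.
- rewrite lawE (le_lt_trans (probability_le1 _ _)) ?ltry//.
  by apply: measurable_funPTI; apply: measurable_cell_event; exact: measurable_config_preimage.
- by move=> A cA; rewrite lawE h.
Qed.

Lemma configuration_integral (nu : {measure set T -> \bar R}) (C : set T) (f : T -> R) :
  (forall C, measurable C -> P (G @^-1` cell_event a b [set x | C (q x)]) = nu C) ->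
  measurable C -> measurable_fun setT f -> (forall t, 0 <= f t) ->
  (\int[P]_(w in G @^-1` cell_event a b [set x | C (q x)])
     (f (q (box_vertices a b (G w))))%:E = \int[nu]_(t in C) (f t)%:E)%E.
Proof.
move=> h mC mf f0.
transitivity (\int[law]_(t in C) (f t)%:E)%E; last first.
  by apply: eq_measure_integral => A mA _; rewrite lawE h.
have mF : measurable_fun setT (EFin \o f) by exact/measurable_EFinP.
rewrite ge0_integral_pushforward//; last 2 first.
- exact: measurable_funTS.
- by move=> t _; rewrite lee_fin.
rewrite ge0_integral_mrestr_setI//; last 3 first.
- by rewrite -[X in measurable X]setTI; exact: mY.
- exact: (measurableT_comp mF mY).
- by move=> w; rewrite lee_fin.
Qed.

End configuration_law.

Definition double_pattern (E : seq ((bool * bool) * (bool * bool))) :=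
  [seq ((s, p.1), (s, p.2)) | s <- [:: false; true], p <- E].

Definition double_boxes T (a a' : bool * bool -> T) (k : bool * (bool * bool)) : T :=
  if k.1 then a' k.2 else a k.2.

Section cells.
Context (R : realType) (dO : measure_display) (Omega : measurableType dO).
Variables (P : probability Omega R) (d : nat) (lambda : R).
Variables (G : {mfun Omega >-> spatial_graph R d}) (X : nat -> {mfun Omega >-> 'rV[R]_d}).
Hypotheses (lambda_gt0 : 0 < lambda)
  (hP : homogeneous_poisson P lambda (fun w => vertices (G w)))
  (hX : enumerates_vertices P G X).
Local Notation V := 'rV[R]_d.
Local Notation Q := (bool * bool)%type.

Lemma cell_lawP (a b : Q -> V) (C : set (quad V)) :
  trivIset setT (fun i => box (a i) (b i)) -> measurable C ->
  P (G @^-1` cell_event a b [set x | C (mkquad x)]) = cell_law lambda a b C.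
Proof.
move=> tB mC.
apply: (configuration_law_determined (@measurable_mkquad R d) (@determining_quad R d)) => //.
  by rewrite -ge0_fin_numE//; exact: cell_law_fin.
move=> _ [_ [A1 mA1 [A2 mA2 ->]] [_ [A3 mA3 [A4 mA4 ->]] ->]].
pose A i := quad_coord ((A1, A2), (A3, A4)) i.
have mA i : measurable (A i) by case: i => -[] [].
apply: etrans (esym (cell_law_rectangle lambda a b mA)).
rewrite -(poisson_single_vertices lambda_gt0 hP tB mA).
congr (P _); apply/seteqP; split => w /=.
  by move=> [s [[h1 h2] [h3 h4]]] [[] []] _; (split; first exact: s).
move=> h; split; first by move=> i _; have [] := h i I.
split; split => /=.
- by have [] := h (false, false) I.
- by have [] := h (false, true) I.
- by have [] := h (true, false) I.
- by have [] := h (true, true) I.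
Qed.

Definition mkquad2 (x : bool * Q -> V) : quad V * quad V :=
  (mkquad (fun i => x (false, i)), mkquad (fun i => x (true, i))).

Lemma double_cell_lawP (a b a' b' : Q -> V) (C : set (quad V * quad V)) :
  trivIset setT (fun k => box (double_boxes a a' k) (double_boxes b b' k)) ->
  measurable C ->
  P (G @^-1` cell_event (double_boxes a a') (double_boxes b b') [set x | C (mkquad2 x)]) =
  (cell_law lambda a b \x cell_law lambda a' b')%E C.
Proof.
move=> tB mC.
apply: (configuration_law_determined (q := mkquad2) _
  (determining_rectangles (@quad_rectangles_measurable R d)
    (@determining_quad R d) (@determining_quad R d))) => //.
- move=> dW W Y mY; apply: measurable_fun_pair; apply: measurable_mkquad => i; exact: mY.
- rewrite -setXTT [X in (X < _)%E]product_measure1E// lte_mul_pinfty// ?cell_law_fin//.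
  by rewrite -ge0_fin_numE// cell_law_fin.
move=> _ [_ [_ [A1 mA1 [A2 mA2 ->]] [_ [A3 mA3 [A4 mA4 ->]] ->]]
  [_ [_ [B1 mB1 [B2 mB2 ->]] [_ [B3 mB3 [B4 mB4 ->]] ->]] ->]].
pose A i := quad_coord ((A1, A2), (A3, A4)) i.
pose B i := quad_coord ((B1, B2), (B3, B4)) i.
have mA i : measurable (A i) by case: i => -[] [].
have mB i : measurable (B i) by case: i => -[] [].
rewrite [RHS]product_measure1E; [|by do !apply: measurableX|by do !apply: measurableX].
transitivity ((\prod_i point_law lambda (a i) (b i) (A i)) *
    (\prod_i point_law lambda (a' i) (b' i) (B i)))%E; last first.
  congr (_ * _)%E; first exact: (esym (cell_law_rectangle lambda a b mA)).
  exact: (esym (cell_law_rectangle lambda a' b' mB)).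
have mD k : measurable (double_boxes A B k) by case: k => -[] i; [exact: mB|exact: mA].
transitivity (\prod_k point_law lambda (double_boxes a a' k) (double_boxes b b' k)
    (double_boxes A B k))%E; last first.
  rewrite (eq_bigr (fun k => point_law lambda (double_boxes a a' (k.1, k.2))
    (double_boxes b b' (k.1, k.2)) (double_boxes A B (k.1, k.2)))); last by case.
  rewrite -(pair_bigA _ (fun s i => point_law lambda (double_boxes a a' (s, i))
    (double_boxes b b' (s, i)) (double_boxes A B (s, i))))/= big_bool muleC.
  by [].
rewrite -(poisson_single_vertices lambda_gt0 hP tB mD).
congr (P _); apply/seteqP; split => w /=.
  move=> [s [[[h1 h2] [h3 h4]] [[h5 h6] [h7 h8]]]] [[] [[] []]] _;
    by (split; first exact: s).
move=> h; split; first by move=> i _; have [] := h i I.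
split; split; split => /=.
- by have [] := h (false, (false, false)) I.
- by have [] := h (false, (false, true)) I.
- by have [] := h (false, (true, false)) I.
- by have [] := h (false, (true, true)) I.
- by have [] := h (true, (false, false)) I.
- by have [] := h (true, (false, true)) I.
- by have [] := h (true, (true, false)) I.
- by have [] := h (true, (true, true)) I.
Qed.

Variables (E : seq (Q * Q)) (F : (Q -> V) -> R).
Hypotheses (F0 : forall x, 0 <= F x) (mF : measurable_statistic F).
Hypothesis hE : edge_law P G X E F.

Let mFq := measurable_quad_statistic mF.

Lemma one_cell_probability (a b : Q -> V) (C : set (quad V)) :
  trivIset setT (fun i => box (a i) (b i)) -> measurable C ->
  P (G @^-1` pattern_event a b [set x | C (mkquad x)] E) =
  (\int[cell_law lambda a b]_(t in C) (F (quad_coord t))%:E)%E.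
Proof.
move=> tB mC; rewrite (edge_formula tB hX hE)//; last first.
  exact: (measurable_config_preimage (@measurable_mkquad R d) mC).
rewrite -(configuration_integral (P := P) (G := G) (q := @mkquad V) (a := a) (b := b)
  (@measurable_mkquad R d) _ mC mFq)//.
  by apply: eq_integral => w _; rewrite mkquadK.
by move=> D mD; exact: cell_lawP.
Qed.

Hypothesis hE2 : edge_law P G X (double_pattern E)
  (fun x => F (fun i => x (false, i)) * F (fun i => x (true, i))).

(** Two cells form one configuration of eight points, for which both the law of the
locations and the conditional edge probability factor. *)
Lemma two_cells_probability (a b a' b' : Q -> V) (C C' : set (quad V)) :
  trivIset setT (fun k => box (double_boxes a a' k) (double_boxes b b' k)) ->
  measurable C -> measurable C' ->
  P (G @^-1` (pattern_event a b [set x | C (mkquad x)] E `&`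
              pattern_event a' b' [set x | C' (mkquad x)] E)) =
  (\int[cell_law lambda a b]_(t in C) (F (quad_coord t))%:E *
   \int[cell_law lambda a' b']_(t in C') (F (quad_coord t))%:E)%E.
Proof.
move=> tB mC mC'.
have mq2 dW (W : measurableType dW) (Y : bool * Q -> W -> V) :
    (forall i, measurable_fun setT (Y i)) ->
    measurable_fun setT (fun w => mkquad2 (fun i => Y i w)).
  by move=> mY; apply: measurable_fun_pair; apply: measurable_mkquad => i; exact: mY.
have mCC : measurable (C `*` C') by exact: measurableX.
have -> : pattern_event a b [set x | C (mkquad x)] E `&`
    pattern_event a' b' [set x | C' (mkquad x)] E =
    pattern_event (double_boxes a a') (double_boxes b b')
      [set x | (C `*` C') (mkquad2 x)] (double_pattern E).
  apply/seteqP; split => g /=.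
    move=> [[[s Cg] h] [[s' Cg'] h']]; split; first split.
    - by move=> [[] i] _; [exact: s'|exact: s].
    - by [].
    move=> p /allpairsP[[[] r] /= [_ rE ->]]; [exact: h'|exact: h].
  move=> [[s [/= Cg Cg']] h]; split; split.
  - by split => // i _; exact: (s (false, i) I).
  - move=> p pE; apply: (h ((false, p.1), (false, p.2))).
    by apply/allpairsP; exists (false, p).
  - by split => // i _; exact: (s (true, i) I).
  - move=> p pE; apply: (h ((true, p.1), (true, p.2))).
    by apply/allpairsP; exists (true, p).
rewrite (edge_formula tB hX hE2); first last.
- by move=> x; exact: mulr_ge0.
- move=> dW W Y mY; apply: measurable_funM.
    by apply: (mF (Y := fun i w => Y (false, i) w)).
  by apply: (mF (Y := fun i w => Y (true, i) w)).
- exact: (measurable_config_preimage mq2 mCC).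
rewrite -integral_product_split//.
pose f (z : quad V * quad V) := F (quad_coord z.1) * F (quad_coord z.2).
have mf : measurable_fun setT f.
  by apply: measurable_funM; apply: (measurableT_comp mFq).
rewrite -(configuration_integral (P := P) (G := G) (a := double_boxes a a')
  (b := double_boxes b b') mq2 _ mCC mf)//.
- by apply: eq_integral => w _; rewrite /f /mkquad2 /= !mkquadK.
- by move=> D mD; exact: double_cell_lawP.
- by move=> z; exact: mulr_ge0.
Qed.

End cells.

(** * The pattern K_{2,2} *)

Definition K22 : seq ((bool * bool) * (bool * bool)) :=
  [seq ((false, k), (true, l)) | k <- [:: false; true], l <- [:: false; true]].

Definition test_patterns : seq (seq ((bool * bool) * (bool * bool))) :=
  K22 :: [seq [:: p] | p <- K22].

Lemma test_patterns_simple E : E \in test_patterns ->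
  simple_pattern E && simple_pattern (double_pattern E).
Proof. by move: E; apply/allP. Qed.

Lemma big_quad_bool (A : Type) (idx : A) (op : Monoid.com_law idx) (F : quad bool -> A) :
  \big[op/idx]_z F z = \big[op/idx]_(u : bool * bool) \big[op/idx]_(v : bool * bool) F (u, v).
Proof.
by rewrite pair_bigA; apply: eq_bigr; case.
Qed.

Section statistics.
Context (R : realType) (d : nat).
Local Notation V := 'rV[R]_d.
Local Notation Q := (bool * bool)%type.
Variables (fin fout : R -> R).

Definition cell_statistic E (x : Q -> V) : R :=
  planted_statistic (@quad_coord bool) fin fout E x.

(** The connection probability of a pair is the mean of the two functions plus their
half-difference times the product of the two signs, which averages to zero. *)
Lemma cell_statistic_edge p (x : Q -> V) : p \in K22 ->
  cell_statistic [:: p] x =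
  (fin (enorm (x p.1 - x p.2)) + fout (enorm (x p.1 - x p.2))) / 2.
Proof.
have cQ : #|{: bool * bool}| = 4%N by rewrite card_prod card_bool.
rewrite /cell_statistic /planted_statistic big_quad_bool cQ => pK.
rewrite !big_bool2 /signed_statistic !big_cons !big_nil.
move: pK; rewrite /K22 /= !inE => /or4P[] /eqP -> /=; rewrite /quad_coord /=; lra.
Qed.

(** Around the 4-cycle every sign occurs twice, so of all the products of half-differences
exactly the full one survives the averaging. *)
Lemma cell_statistic_K22 (x : Q -> V) :
  cell_statistic K22 x =
  \prod_(p <- K22) ((fin (enorm (x p.1 - x p.2)) + fout (enorm (x p.1 - x p.2))) / 2) +
  \prod_(p <- K22) ((fin (enorm (x p.1 - x p.2)) - fout (enorm (x p.1 - x p.2))) / 2).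
Proof.
have cQ : #|{: bool * bool}| = 4%N by rewrite card_prod card_bool.
rewrite /cell_statistic /planted_statistic big_quad_bool cQ.
rewrite !big_bool2 /signed_statistic /K22 /= !big_cons !big_nil /= /quad_coord /=.
by field.
Qed.

(** If single edges do not distinguish the two models at x then g is the mean of the
two connection functions on all four pairs, and the 4-cycle distinguishes them. *)
Lemma test_patterns_separate (g : R -> R) (x : Q -> V) :
  (forall p, p \in K22 -> fout (enorm (x p.1 - x p.2)) < fin (enorm (x p.1 - x p.2))) ->
  exists2 E, E \in test_patterns & cell_statistic E x <> rcm_statistic g E x.
Proof.
move=> hlt; apply: contrapT => H.
have {}H E : E \in test_patterns -> cell_statistic E x = rcm_statistic g E x.
  by move=> EK; apply: contrapT => ne; apply: H; exists E.
have gmean p : p \in K22 -> g (enorm (x p.1 - x p.2)) =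
    (fin (enorm (x p.1 - x p.2)) + fout (enorm (x p.1 - x p.2))) / 2.
  move=> pK; rewrite -cell_statistic_edge// H; last first.
    by rewrite in_cons; apply/orP; right; apply/mapP; exists p.
  by rewrite /rcm_statistic big_seq1.
have prodE : \prod_(p <- K22) g (enorm (x p.1 - x p.2)) = \prod_(p <- K22)
    ((fin (enorm (x p.1 - x p.2)) + fout (enorm (x p.1 - x p.2))) / 2).
  by rewrite big_seq [RHS]big_seq; apply: eq_bigr => p /gmean.
have := H K22 (mem_head _ _); rewrite cell_statistic_K22 /rcm_statistic prodE.
rewrite -[RHS]addr0 => /addrI /eqP.
apply/negP; rewrite gt_eqF// big_seq prodr_gt0// => p pK.
by rewrite divr_gt0// subr_gt0 hlt.
Qed.

End statistics.

Lemma rcm_statistic_double (R : realType) (d : nat) (g : R -> R) E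
    (x : bool * (bool * bool) -> 'rV[R]_d) :
  rcm_statistic g (double_pattern E) x =
  rcm_statistic g E (fun i => x (false, i)) * rcm_statistic g E (fun i => x (true, i)).
Proof.
by rewrite /rcm_statistic /double_pattern big_allpairs_dep/= !big_cons big_nil mulr1.
Qed.

Definition double_signs (z : quad bool * quad bool) (k : bool * (bool * bool)) : bool :=
  quad_coord (if k.1 then z.2 else z.1) k.2.

Lemma planted_statistic_double (R : realType) (d : nat) (fin fout : R -> R) E
    (x : bool * (bool * bool) -> 'rV[R]_d) :
  planted_statistic double_signs fin fout (double_pattern E) x =
  cell_statistic fin fout E (fun i => x (false, i)) *
  cell_statistic fin fout E (fun i => x (true, i)).
Proof.
rewrite /cell_statistic /planted_statistic mulrACA -exprD.
have -> : (#|{: bool * (bool * bool)}| = #|{: bool * bool}| + #|{: bool * bool}|)%N.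
  by rewrite !card_prod !card_bool.
congr (_ * _); rewrite big_distrl/=.
under [RHS]eq_bigr do rewrite big_distrr/=.
rewrite [RHS]pair_bigA; apply: eq_bigr => -[z z'] _ /=.
by rewrite /signed_statistic /double_pattern big_allpairs_dep/= !big_cons big_nil mulr1.
Qed.

Lemma quad_coord_surj (f : bool * bool -> bool) : exists z, quad_coord z =1 f.
Proof. by exists (mkquad f); rewrite mkquadK. Qed.

Lemma quad_coord_inj (z z' : quad bool) : quad_coord z =1 quad_coord z' -> z = z'.
Proof. by move=> /funext h; rewrite -(quad_coordK z) h quad_coordK. Qed.

Lemma double_signs_surj (f : bool * (bool * bool) -> bool) : exists z, double_signs z =1 f.
Proof.
exists (mkquad (fun i => f (false, i)), mkquad (fun i => f (true, i))) => -[[] i];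
  by rewrite /double_signs /= mkquadK.
Qed.

Lemma double_signs_inj (z z' : quad bool * quad bool) :
  double_signs z =1 double_signs z' -> z = z'.
Proof.
case: z z' => [u v] [u' v'] h; congr pair; apply: quad_coord_inj => i.
  exact: (h (false, i)).
exact: (h (true, i)).
Qed.

(** * A weak law of large numbers separating two laws *)

Section pairwise_uncorrelated.
Context d (T : measurableType d) (R : realType) (mu : probability T R).
Variables (S : nat -> set T) (p : R).
Hypotheses (mS : forall k, measurable (S k)) (muS : forall k, mu (S k) = p%:E)
  (muSS : forall k l, k <> l -> mu (S k `&` S l) = (p * p)%:E).

Definition hits (n : nat) (x : T) : R := \sum_(k < n) \1_(S k) x.

Lemma hits_ge0 n x : 0 <= hits n x.
Proof. by apply: sumr_ge0 => k _; rewrite indicE. Qed.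

Lemma measurable_hits n : measurable_fun setT (hits n).
Proof. by apply: measurable_sum => k; exact: measurable_indic. Qed.

Let p0 : 0 <= p.
Proof. by rewrite -lee_fin -(muS 0). Qed.

Let p1 : p <= 1.
Proof. by rewrite -lee_fin -(muS 0); exact: probability_le1. Qed.

Lemma integral_hits n : (\int[mu]_x (hits n x)%:E = (n%:R * p)%:E)%E.
Proof.
under eq_integral do rewrite /hits -sumEFin.
rewrite ge0_integral_sum//; last by move=> k; apply/measurable_EFinP; exact: measurable_indic.
rewrite (eq_bigr (fun=> p%:E)); last first.
  by move=> k _; rewrite integral_indic// setIT; exact: muS.
by rewrite sumEFin sumr_const card_ord mulr_natl.
Qed.

Lemma integral_hits_sqr n : (\int[mu]_x (hits n x ^+ 2)%:E =
  (n%:R * p + (n%:R ^+ 2 - n%:R) * (p * p))%:E)%E.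
Proof.
have E x : (hits n x ^+ 2)%:E = (\sum_(k < n) \sum_(l < n) (\1_(S k `&` S l) x)%:E)%E.
  rewrite expr2 /hits big_distrlr/= -sumEFin; apply: eq_bigr => k _.
  by rewrite -sumEFin; apply: eq_bigr => l _; rewrite indicI.
have mi k l : measurable_fun setT (fun x => (\1_(S k `&` S l) x : R)%:E).
  by apply/measurable_EFinP; apply: measurable_indic; exact: measurableI.
under eq_integral do rewrite E.
rewrite ge0_integral_sum//; last 2 first.
- by move=> k; exact: emeasurable_sum.
- by move=> k x _; apply: sume_ge0 => l _; rewrite lee_fin indicE.
transitivity (\sum_(k < n) (p + (n%:R - 1) * (p * p))%:E)%E.
  apply: eq_bigr => k _; rewrite ge0_integral_sum//.
  rewrite (bigD1 k)//= integral_indic//; last exact: measurableI.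
  rewrite setIT setIid EFinD; congr (_ + _)%E; first exact: muS.
  rewrite (eq_bigr (fun=> (p * p)%:E)); last first.
    move=> l lk; rewrite integral_indic//; last exact: measurableI.
    rewrite setIT; apply: muSS => /ord_inj kl; by rewrite kl eqxx in lk.
  rewrite sumEFin sumr_const; congr EFin.
  have -> : #|(fun i : 'I_n => i != k)| = n.-1 by rewrite cardC1 card_ord.
  rewrite -[(p * p) *+ _]mulr_natl; congr (_ * _).
  by rewrite -subn1 natrB// (leq_trans _ (ltn_ord k)).
by rewrite sumEFin sumr_const card_ord; congr EFin; rewrite -[LHS]mulr_natl; ring.
Qed.

(** Chebyshev's inequality: pairwise uncorrelated events suffice for the variance of
the count to grow linearly. *)
Lemma hits_deviation n (e : R) : 0 < e -> (0 < n)%N ->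
  (mu [set x | (n%:R * e <= `|hits n x - n%:R * p|)%R] <= (n%:R * e ^+ 2)^-1%:E)%E.
Proof.
move=> e0 n0.
have nR0 : 0 < n%:R :> R by rewrite ltr0n.
have mh := measurable_hits n.
have mD : measurable_fun setT (fun x => (hits n x - n%:R * p) ^+ 2).
  by apply: measurable_funX; apply: measurable_funB => //; exact: measurable_cst.
have ivar : (\int[mu]_x ((hits n x - n%:R * p) ^+ 2)%:E <= n%:R%:E)%E.
  have key : (\int[mu]_x ((hits n x - n%:R * p) ^+ 2)%:E +
      (2 * (n%:R * p) * (n%:R * p))%:E =
      (n%:R * p + (n%:R ^+ 2 - n%:R) * (p * p))%:E + ((n%:R * p) ^+ 2)%:E)%E.
    rewrite -integral_hits_sqr.
    have -> : (((n%:R * p) ^+ 2)%:E = \int[mu]_x ((n%:R * p) ^+ 2)%:E)%E.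
      by rewrite integral_cst// [X in (_ * X)%E]probability_setT mule1.
    have -> : ((2 * (n%:R * p) * (n%:R * p))%:E =
        \int[mu]_x ((2 * (n%:R * p)) * hits n x)%:E)%E.
      under [RHS]eq_integral do rewrite EFinM.
      rewrite ge0_integralZl//; last 3 first.
      - exact/measurable_EFinP.
      - by move=> x _; rewrite lee_fin hits_ge0.
      - by rewrite lee_fin !mulr_ge0.
      by rewrite integral_hits -EFinM.
    rewrite -!ge0_integralD//.
    - by apply: eq_integral => x _; rewrite -!EFinD; congr EFin; ring.
    - by move=> x _; rewrite lee_fin sqr_ge0.
    - by apply/measurable_EFinP; exact: measurable_funX.
    - by move=> x _; rewrite lee_fin sqr_ge0.
    - by move=> x _; rewrite lee_fin sqr_ge0.
    - exact/measurable_EFinP.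
    - by move=> x _; rewrite lee_fin !mulr_ge0// hits_ge0.
    - by apply/measurable_EFinP; apply: measurable_funM => //; exact: measurable_cst.
  have -> : (\int[mu]_x ((hits n x - n%:R * p) ^+ 2)%:E = (n%:R * (p - p * p))%:E)%E.
    move: key; case: (\int[mu]_x _)%E => [r| |] //.
    by rewrite -!EFinD => -[h]; congr EFin; apply: (addIr (2 * (n%:R * p) * (n%:R * p))); rewrite h; ring.
  rewrite lee_fin -[leRHS]mulr1 ler_wpM2l// lerBlDr (le_trans p1)// lerDl.
  exact: mulr_ge0.
pose c := (n%:R * e) ^+ 2.
have c0 : 0 < c by rewrite exprn_gt0// mulr_gt0.
set A := [set x | _].
have AE : A = [set x | c <= (hits n x - n%:R * p) ^+ 2].
  apply/seteqP; split => x /=; rewrite /A /c /= -(@real_normK _ (hits n x - n%:R * p)) ?num_real//;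
    by rewrite ler_pXn2r// ?nnegrE// ltW// mulr_gt0.
have mA : measurable A.
  rewrite AE (_ : [set x | _] = (fun x => (hits n x - n%:R * p) ^+ 2) @^-1` `[c, +oo[).
    by rewrite -[X in measurable X]setTI; exact: mD.
  by apply/seteqP; split => x /=; rewrite in_itv/= andbT.
have cA : (c%:E * mu A <= n%:R%:E)%E.
  apply: le_trans ivar; rewrite -integral_cst//.
  apply: (@le_trans _ _ (\int[mu]_(x in A) ((hits n x - n%:R * p) ^+ 2)%:E)%E).
    apply: ge0_le_integral => //.
    - by move=> x _; rewrite lee_fin ltW.
    - by apply/measurable_EFinP; exact: measurable_funTS.
    - by move=> x; rewrite AE /= lee_fin.
  apply: ge0_subset_integral => //; first exact/measurable_EFinP.
  by move=> x _; rewrite lee_fin sqr_ge0.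
rewrite -(@lee_pmul2l _ c%:E) ?lte_fin//; apply: (le_trans cA).
rewrite -EFinM lee_fin /c exprMn invfM mulrACA expr2 mulfK ?gt_eqF//.
by rewrite mulfV ?mulr1// gt_eqF// exprn_gt0.
Qed.

End pairwise_uncorrelated.

(** Two laws giving different frequencies to pairwise uncorrelated events: along
n = 2 ^ m the deviations are summable, and the Borel-Cantelli lemma applies. *)
Lemma singular_of_frequencies d (T : measurableType d) (R : realType)
    (mu nu : probability T R) (S : nat -> set T) (p q : R) :
  (forall k, measurable (S k)) -> p <> q ->
  (forall k, mu (S k) = p%:E) -> (forall k, nu (S k) = q%:E) ->
  (forall k l, k <> l -> mu (S k `&` S l) = (p * p)%:E) ->
  (forall k l, k <> l -> nu (S k `&` S l) = (q * q)%:E) ->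
  exists A, [/\ measurable A, mu A = 0%E & nu (~` A) = 0%E].
Proof.
move=> mS pq muS nuS muSS nuSS.
pose e := `|p - q| / 2.
have e0 : 0 < e by rewrite divr_gt0// normr_gt0 subr_eq0; exact/eqP.
pose h n := @hits _ T R S n.
pose A m := [set x | (`|h (2 ^ m)%N x - (2 ^ m)%:R * q| < (2 ^ m)%:R * e)%R].
have mA m : measurable (A m).
  rewrite (_ : A m = (fun x => `|h (2 ^ m)%N x - (2 ^ m)%:R * q|) @^-1` `]-oo, ((2 ^ m)%:R * e)%R[).
    rewrite -[X in measurable X]setTI.
    have mf : measurable_fun setT (fun x => `|h (2 ^ m)%N x - (2 ^ m)%:R * q|).
      apply: measurableT_comp => //; apply: measurable_funB; last exact: measurable_cst.
      exact: measurable_hits.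
    exact: mf.
  by apply/seteqP; split => x /=; rewrite in_itv.
have n0 m : (0 < 2 ^ m)%N by rewrite expn_gt0.
have bound (P : probability T R) (r : R) B m : measurable B ->
    (forall k, P (S k) = r%:E) -> (forall k l, k <> l -> P (S k `&` S l) = (r * r)%:E) ->
    (B `<=` [set x | ((2 ^ m)%:R * e <= `|h (2 ^ m)%N x - (2 ^ m)%:R * r|)%R]) ->
    (P B <= (2 * (e ^+ 2)^-1 / (2 ^ m.+1)%:R)%:E)%E.
  move=> mB PS PSS sB.
  have := hits_deviation mS PS PSS e0 (n0 m).
  have -> : ((2 ^ m)%:R * e ^+ 2)^-1 = 2 * (e ^+ 2)^-1 / (2 ^ m.+1)%:R :> R.
    rewrite expnS natrM invfM [in RHS]invfM; field.
    by rewrite pnatr_eq0 -lt0n n0 gt_eqF.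
  apply: le_trans; apply: le_measure; rewrite ?inE//.
  rewrite (_ : [set x | _] = (fun x => `|h (2 ^ m)%N x - (2 ^ m)%:R * r|) @^-1` `[((2 ^ m)%:R * e)%R, +oo[).
    rewrite -[X in measurable X]setTI.
    have mf : measurable_fun setT (fun x => `|h (2 ^ m)%N x - (2 ^ m)%:R * r|).
      apply: measurableT_comp => //; apply: measurable_funB; last exact: measurable_cst.
      exact: measurable_hits.
    exact: mf.
  by apply/seteqP; split => x /=; rewrite in_itv/= andbT.
have summ (P : probability T R) (B : nat -> set T) :
    (forall m, (P (B m) <= (2 * (e ^+ 2)^-1 / (2 ^ m.+1)%:R)%:E)%E) ->
    (\sum_(m <oo) P (B m) < +oo)%E.
  move=> PB; apply: (@le_lt_trans _ _ (2 * (e ^+ 2)^-1)%:E); last exact: ltry.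
  apply: (@le_trans _ _ (\sum_(m <oo) (2 * (e ^+ 2)^-1 / (2 ^ m.+1)%:R)%:E)%E).
    by apply: lee_nneseries => // m _; exact: PB.
  by apply: epsilon_trick0; rewrite mulr_ge0// invr_ge0 sqr_ge0.
exists (lim_sup_set A); split.
- apply: bigcap_measurableType => n _; apply: bigcup_measurable => m _; exact: mA.
- apply: lim_sup_set_cvg0 => //; apply: summ => m; apply: (bound mu p) => // x.
  rewrite /A /= => hq.
  have : `|(2 ^ m)%:R * p - (2 ^ m)%:R * q| <=
      `|h (2 ^ m)%N x - (2 ^ m)%:R * q| + `|h (2 ^ m)%N x - (2 ^ m)%:R * p|.
    by rewrite [leRHS]addrC [X in _ <= X + _]distrC ler_distD.
  rewrite -mulrBr normrM ger0_norm//.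
  have -> : `|p - q| = e * 2 by rewrite /e divfK.
  rewrite mulrA => /le_trans hh; rewrite -(lerD2l ((2 ^ m)%:R * e)) -[leLHS]mulr2n -[leLHS]mulr_natr.
  by apply: hh; rewrite lerD2r ltW.
- have mCA m : measurable (~` A m) by exact: measurableC.
  apply: (@subset_measure0 _ _ _ nu _ (lim_sup_set (fun m => ~` A m))).
  + apply: measurableC; apply: bigcap_measurableType => n _.
    by apply: bigcup_measurable => m _; exact: mA.
  + by apply: bigcap_measurableType => n _; apply: bigcup_measurable => m _.
  + move=> x nAx n _; apply: contrapT => H; apply: nAx => k _.
    exists (maxn n k); first by rewrite /= leq_maxr.
    apply: contrapT => nA; apply: H; exists (maxn n k) => //=; exact: leq_maxl.
  + apply: lim_sup_set_cvg0 => //; apply: summ => m; apply: (bound nu q) => // x.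
    by rewrite /A /= => /negP; rewrite -leNgt.
Qed.

(** * Positivity of the 4-cycle density *)

Section four_cycles.
Context (R : realType) (e : nat).
Local Notation V := 'rV[R]_e.+1.
Local Notation u := (@volume R e.+1).

Definition pair_volume : set (V * V)%type -> \bar R := (u \x u)%E.
HB.instance Definition _ := Measure.on pair_volume.

Lemma pair_volume_sigma_finite : sigma_finite setT pair_volume.
Proof.
have /sigma_finiteP[F [TF ndF Foo]] := @volume_sigma_finite R e.+1.
exists (fun n => F n `*` F n).
  apply/esym; rewrite -subTset => -[x y] _.
  have [n _ Fx] : (\bigcup_n F n) x by rewrite -TF.
  have [m _ Fy] : (\bigcup_n F n) y by rewrite -TF.
  exists (maxn n m) => //; split => /=.
    by move: x Fx; exact/subsetPset/ndF/leq_maxl.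
  by move: y Fy; exact/subsetPset/ndF/leq_maxr.
move=> n; have [mF Fn] := Foo n; split; first exact: measurableX.
by rewrite /pair_volume product_measure1E// lte_mul_pinfty// ge0_fin_numE.
Qed.
HB.instance Definition _ := @Measure_isSigmaFinite.Build _ _ _ pair_volume pair_volume_sigma_finite.

Definition quad_volume : set (quad V) -> \bar R := (pair_volume \x pair_volume)%E.
HB.instance Definition _ := Measure.on quad_volume.

Let measurable_sub2 dW (W : measurableType dW) (Y1 Y2 : W -> V) (D : set V) :
  measurable D -> measurable_fun setT Y1 -> measurable_fun setT Y2 ->
  measurable [set w | D (Y1 w - Y2 w)].
Proof.
move=> mD m1 m2; rewrite -[X in measurable X]setTI.
exact: (measurable_rowvec_sub m1 m2 measurableT mD).
Qed.

Variable D : set V.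
Hypotheses (mD : measurable D) (D_gt0 : (0 < u D)%E).

Let cherry : set ((V * V) * V)%type := [set z | D (z.1.1 - z.2) /\ D (z.1.2 - z.2)].

Let mcherry : measurable cherry.
Proof.
apply: measurableI; apply: (measurable_sub2 mD).
- exact: (measurableT_comp measurable_fst measurable_fst).
- exact: measurable_snd.
- exact: (measurableT_comp measurable_snd measurable_fst).
- exact: measurable_snd.
Qed.

Let codegree (z : V * V) : \bar R := u (xsection cherry z).

Let mcodegree : measurable_fun setT codegree.
Proof. exact: (measurable_fun_xsection u mcherry). Qed.

(* Integrated first over its two ends, a cherry has density (u D)^2 at every middle point. *)
Let integral_codegree_neq0 : (\int[pair_volume]_z codegree z <> 0)%E.
Proof.
have -> : (\int[pair_volume]_z codegree z =
    \int[u]_r pair_volume (ysection cherry r))%E.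
  have := indic_fubini_tonelli pair_volume u mcherry.
  have -> := indic_fubini_tonelli_FE u mcherry.
  by have -> := indic_fubini_tonelli_GE pair_volume mcherry.
have -> : (\int[u]_r pair_volume (ysection cherry r) = \int[u]_r (u D * u D))%E.
  apply: eq_integral => r _.
  rewrite (_ : ysection cherry r =
    ((fun x => x + - r) @^-1` D) `*` ((fun x => x + - r) @^-1` D)).
    rewrite /pair_volume product_measure1E.
    - by congr (_ * _)%E; exact: (volume_translate (- r) mD).
    - by rewrite -[X in measurable X]setTI; exact: measurable_translate.
    - by rewrite -[X in measurable X]setTI; exact: measurable_translate.
  by apply/seteqP; split => -[x y]; rewrite /ysection /= inE.
rewrite integral_cst// => /eqP; apply/negP; rewrite gt_eqF//.
rewrite !mule_gt0//.
pose B : set V := box (const_mx (-1)) (const_mx 1).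
have : (0 < u B)%E.
  rewrite volume_box; last by move=> i; rewrite !mxE; lra.
  by rewrite lte_fin prodr_gt0// => i _; rewrite !mxE; lra.
move=> /lt_le_trans; apply; apply: le_measure; rewrite ?inE//.
exact: measurable_box.
Qed.

Definition four_cycle : set (quad V) :=
  [set t | [/\ D (t.1.1 - t.2.1), D (t.1.1 - t.2.2), D (t.1.2 - t.2.1) & D (t.1.2 - t.2.2)]].

Lemma measurable_four_cycle : measurable four_cycle.
Proof.
have m11 : measurable_fun [set: quad V] (fun t => t.1.1).
  exact: (measurableT_comp measurable_fst measurable_fst).
have m12 : measurable_fun [set: quad V] (fun t => t.1.2).
  exact: (measurableT_comp measurable_snd measurable_fst).
have m21 : measurable_fun [set: quad V] (fun t => t.2.1).
  exact: (measurableT_comp measurable_fst measurable_snd).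
have m22 : measurable_fun [set: quad V] (fun t => t.2.2).
  exact: (measurableT_comp measurable_snd measurable_snd).
rewrite (_ : four_cycle = ([set t : quad V | D (t.1.1 - t.2.1)] `&` [set t | D (t.1.1 - t.2.2)]) `&`
    ([set t | D (t.1.2 - t.2.1)] `&` [set t | D (t.1.2 - t.2.2)])).
  by apply: measurableI; apply: measurableI; exact: (measurable_sub2 mD).
by apply/seteqP; split => t /=; [case|move=> [[? ?] [? ?]]].
Qed.

(** Given two opposite corners the other two are free common neighbours, so the density
of 4-cycles is the integral of the squared codegree; it vanishes only if the
codegree does, but the codegree integrates to the squared degree. *)
Lemma four_cycle_neq0 : quad_volume four_cycle <> 0%E.
Proof.
move=> H; apply: integral_codegree_neq0.
have sq : (\int[pair_volume]_z (codegree z * codegree z) = 0)%E.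
  rewrite -H /quad_volume /product_measure1; apply: eq_integral => z _ /=.
  rewrite (_ : xsection four_cycle z = xsection cherry z `*` xsection cherry z).
    by rewrite /pair_volume product_measure1E//; exact: measurable_xsection.
  apply/seteqP; split => -[x y]; rewrite /xsection /= !inE /four_cycle /cherry /=.
    by case.
  by move=> [[? ?] [? ?]].
have cod0 z : (0 <= codegree z)%E by exact: measure_ge0.
have msq : measurable_fun setT (fun z => codegree z * codegree z)%E by exact: emeasurable_funM.
have := measure0_of_integral0 measurableT msq (fun z _ => mule_ge0 (cod0 z) (cod0 z)) sq.
rewrite setTI; set N := [set z | _] => N0.
have mN : measurable N.
  rewrite (_ : N = (fun z => codegree z * codegree z)%E @^-1` `]0%E, +oo[%classic).
    by rewrite -[X in measurable X]setTI; apply: msq => //; exact: emeasurable_itv.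
  by apply/seteqP; split => x /=; rewrite in_itv/= andbT.
rewrite (ge0_negligible_integral (N := N))//.
rewrite setTD; apply: integral0_eq => z Nz; apply/eqP; rewrite eq_le cod0 andbT leNgt.
by apply/negP => cz; apply: Nz; rewrite /N /=; exact: mule_gt0.
Qed.

End four_cycles.

Section disjoint_boxes.
Context (R : realType) (e : nat).
Local Notation V := 'rV[R]_e.+1.
Local Notation u := (@volume R e.+1).
Local Notation Q := (bool * bool)%type.

Definition rat_row (v : 'rV[rat]_e.+1) : V := map_mx ratr v.

Lemma rational_box (x : V) (r : R) : 0 < r -> exists a b : 'rV[rat]_e.+1,
  box (rat_row a) (rat_row b) x /\
  forall y, box (rat_row a) (rat_row b) y -> forall k, `|y ord0 k - x ord0 k| < r.
Proof.
move=> r0.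
have /choice[a ha] k : exists q : rat, x ord0 k - r < ratr q < x ord0 k.
  have [|q] := @rat_in_itvoo R (x ord0 k - r) (x ord0 k); first by rewrite ltrBlDr ltrDl.
  by rewrite in_itv/=; exists q.
have /choice[b hb] k : exists q : rat, x ord0 k < ratr q < x ord0 k + r.
  have [|q] := @rat_in_itvoo R (x ord0 k) (x ord0 k + r); first by rewrite ltrDl.
  by rewrite in_itv/=; exists q.
exists (\row_k a k), (\row_k b k); split => [k|y hy k].
  by rewrite !mxE; have /andP[_ ->] := ha k; have /andP[-> _] := hb k.
have := hy k; rewrite !mxE => /andP[ay yb].
have /andP[a1 _] := ha k; have /andP[_ b1] := hb k.
by rewrite ltr_distl (lt_trans a1 ay) (lt_trans yb b1).
Qed.

(** Distinct points lie in pairwise disjoint rational boxes, of which there are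
countably many. *)
Lemma separating_rational_boxes (J : finType) (x : J -> V) : injective x ->
  exists c : {ffun J -> 'rV[rat]_e.+1 * 'rV[rat]_e.+1},
    trivIset setT (fun i => box (rat_row (c i).1) (rat_row (c i).2)) /\
    forall i, box (rat_row (c i).1) (rat_row (c i).2) (x i).
Proof.
move=> ix.
pose N (v : V) : R := \sum_k `|v ord0 k|.
pose m : R := \big[Order.min/1]_(p : J * J | p.1 != p.2) N (x p.1 - x p.2).
have m0 : 0 < m.
  apply: lt_bigmin => [|[i j] /= ij]; first exact: ltr01.
  rewrite lt_neqAle sumr_ge0 ?andbT// eq_sym; apply: contra ij => /eqP Nij.
  apply/eqP/ix/rowP => k; apply/eqP; rewrite -subr_eq0 -normr_eq0.
  have /psumr_eq0P := Nij => /(_ (fun _ _ => normr_ge0 _) k isT) <-.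
  by rewrite !mxE.
have [q qE] : exists q : R, q = e.+1%:R by exists e.+1%:R.
have q0 : 0 < q by rewrite qE.
pose r := m / (4 * q).
have r0 : 0 < r by rewrite divr_gt0// mulr_gt0.
have /choice[c hc] i : exists c : 'rV[rat]_e.+1 * 'rV[rat]_e.+1,
    box (rat_row c.1) (rat_row c.2) (x i) /\
    forall y, box (rat_row c.1) (rat_row c.2) y -> forall k, `|y ord0 k - x i ord0 k| < r.
  by have [a [b h]] := rational_box (x i) r0; exists (a, b).
exists [ffun i => c i]; split => [i j _ _|i]; last by rewrite ffunE; have [] := hc i.
rewrite !ffunE => -[y [yi yj]]; apply/eqP; apply: contraT => ij.
have : N (x i - x j) <= m / 2.
  apply: (@le_trans _ _ (\sum_(k < e.+1) (r + r))).
    apply: ler_sum => k _; rewrite !mxE.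
    have h1 := (hc i).2 _ yi k; have h2 := (hc j).2 _ yj k.
    rewrite (le_trans (ler_distD (y ord0 k) _ _))// distrC.
    by apply: lerD; apply: ltW.
  rewrite sumr_const card_ord -[leLHS]mulr_natr -qE /r.
  by rewrite le_eqVlt; apply/orP; left; apply/eqP; field; rewrite gt_eqF.
have : m <= N (x i - x j) by apply: (bigmin_le_cond _ (j := (i, j))).
by move=> /le_trans /[apply]; rewrite ler_pdivlMr// ger_pMr//; lra.
Qed.

Let pair_diagonal : pair_volume [set z : V * V | z.1 = z.2] = 0%E.
Proof.
rewrite /pair_volume /product_measure1; apply: integral0_eq => x _ /=.
rewrite (_ : xsection _ x = [set x]); first exact: volume1.
by apply/seteqP; split => y; rewrite /xsection /= inE.
Qed.

Let mdiag : measurable [set z : V * V | z.1 = z.2].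
Proof.
rewrite (_ : [set z | _] = (fun z : V * V => z.1 - z.2) @^-1` [set 0]).
  rewrite -[X in measurable X]setTI.
  exact: (measurable_rowvec_sub measurable_fst measurable_snd measurableT (measurable_rowvec1 0)).
by apply/seteqP; split => z /= => [->|/eqP]; rewrite ?subrr// subr_eq0 => /eqP.
Qed.

Definition quad_box (a b : Q -> V) : set (quad V) :=
  [set t | forall i, box (a i) (b i) (quad_coord t i)].

Let quad_boxE a b : quad_box a b =
  (box (a (false, false)) (b (false, false)) `*` box (a (false, true)) (b (false, true))) `*`
  (box (a (true, false)) (b (true, false)) `*` box (a (true, true)) (b (true, true))).
Proof.
apply/seteqP; split => -[[p q] [r s]] /= h.
  split; split => /=.
  - exact: (h (false, false)).
  - exact: (h (false, true)).
  - exact: (h (true, false)).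
  - exact: (h (true, true)).
by case: h => -[/= h1 h2] [/= h3 h4] [[] []].
Qed.

Lemma measurable_quad_box a b : measurable (quad_box a b).
Proof.
by rewrite quad_boxE; apply: measurableX; apply: measurableX; exact: measurable_box.
Qed.

(** Configurations with coinciding points are null, and the others are covered by
countably many quadruples of disjoint boxes, one of which must carry mass. *)
Lemma four_cycle_in_boxes (D : set V) :
  measurable D -> (0 < u D)%E -> (forall x, D x -> x <> 0) ->
  exists a b : Q -> V, trivIset setT (fun i => box (a i) (b i)) /\
    quad_volume (four_cycle D `&` quad_box a b) <> 0%E.
Proof.
move=> mD D_gt0 D0; apply: contrapT => H; apply: (four_cycle_neq0 mD D_gt0).
have mF := measurable_four_cycle mD.
apply/negligibleP => //.
pose I4 := {ffun Q -> 'rV[rat]_e.+1 * 'rV[rat]_e.+1}.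
pose A (c : I4) i := rat_row (c i).1.
pose B (c : I4) i := rat_row (c i).2.
pose F n := if @choice.pickle_inv I4 n is Some c then
  if `[< trivIset setT (fun i => box (A c i) (B c i)) >]
  then four_cycle D `&` quad_box (A c) (B c) else set0 else set0.
apply: (negligibleS (A := ([set z : V * V | z.1 = z.2] `*` setT) `|`
   (setT `*` [set z : V * V | z.1 = z.2]) `|` \bigcup_n F n)).
  move=> t ft; have [h1|n1] := eqVneq t.1.1 t.1.2; first by left; left.
  have [h2|n2] := eqVneq t.2.1 t.2.2; first by left; right.
  right; have [c [tc hc]] : exists c : I4, trivIset setT (fun i => box (A c i) (B c i)) /\
      quad_box (A c) (B c) t.
    apply: separating_rational_boxes.
    have Dne x y : D (x - y) -> x <> y by move=> /D0 h xy; apply: h; rewrite xy subrr.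
    move: n1 n2 => /eqP n1 /eqP n2; case: ft => /Dne h1 /Dne h2 /Dne h3 /Dne h4.
    by move=> [[] []] [[] []] //; rewrite /quad_coord /= => E; exfalso;
      first [exact: n1 E|exact: n1 (esym E)|exact: n2 E
      |exact: n2 (esym E)|exact: h1 E|exact: h1 (esym E)|exact: h2 E|exact: h2 (esym E)
      |exact: h3 E|exact: h3 (esym E)|exact: h4 E|exact: h4 (esym E)].
  exists (choice.pickle c) => //; rewrite /F choice.pickleK_inv asboolT//.
apply: negligibleU; first apply: negligibleU.
- apply/negligibleP; first exact: measurableX.
  by rewrite [LHS]product_measure1E// [X in (X * _)%E]pair_diagonal mul0e.
- apply/negligibleP; first exact: measurableX.
  by rewrite [LHS]product_measure1E// [X in (_ * X)%E]pair_diagonal mule0.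
apply: negligible_bigcup => n; rewrite /F.
case: choice.pickle_inv => [c|]; last exact: negligible_set0.
case: asboolP => tc; last exact: negligible_set0.
apply/negligibleP; first by apply: measurableI => //; exact: measurable_quad_box.
by apply: contrapT => h; apply: H; exists (A c), (B c).
Qed.

(** On its boxes a cell law is a positive multiple of Lebesgue measure. *)
Lemma cell_law_neq0 (lambda : R) (a b : Q -> V) (C : set (quad V)) :
  0 < lambda -> measurable C -> quad_volume (C `&` quad_box a b) <> 0%E ->
  (0 < cell_law lambda a b C)%E.
Proof.
move=> l0 mC H; rewrite lt0e measure_ge0 andbT; apply/negP => /eqP C0; apply: H.
pose w i := `|lambda| * expR (- (lambda * fine (u (box (a i) (b i))))).
have w0 i : 0 < w i by rewrite mulr_gt0 ?normr_gt0 ?gt_eqF// expR_gt0.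
have c0 : 0 < \prod_i w i by apply: prodr_gt0.
have mB := measurable_quad_box a b.
pose m2 := measure_function_mscale__canonical__measure_function_Measure
  (NngNum (ltW c0)) (measure_function_mrestr__canonical__measure_function_Measure
    (@quad_volume R e) mB).
have qvE (A1 A2 A3 A4 : set V) : measurable A1 -> measurable A2 -> measurable A3 ->
    measurable A4 -> quad_volume ((A1 `*` A2) `*` (A3 `*` A4)) =
      (u A1 * u A2 * (u A3 * u A4))%E.
  move=> *; rewrite /quad_volume product_measure1E; [|exact: measurableX|exact: measurableX].
  by congr (_ * _)%E; rewrite /pair_volume [LHS]product_measure1E.
have m2E (S : quad V -> Prop) : m2 S = ((\prod_i w i)%:E * quad_volume (S `&` quad_box a b))%E.
  by [].
have E : cell_law lambda a b C = m2 C.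
  apply: (determining_quad _ (m1 := cell_law lambda a b)) => //.
  - by rewrite -ge0_fin_numE// cell_law_fin.
  - rewrite m2E setTI quad_boxE qvE; try exact: measurable_box.
    have fu i : u (box (a i) (b i)) \is a fin_num by rewrite ge0_fin_numE// volume_box_lty.
    by rewrite ltey_eq; apply/orP; left; rewrite !fin_numM.
  move=> _ [_ [A1 mA1 [A2 mA2 ->]] [_ [A3 mA3 [A4 mA4 ->]] ->]].
  pose A i := quad_coord ((A1, A2), (A3, A4)) i.
  have mA i : measurable (A i) by case: i => -[] [].
  apply: etrans (cell_law_rectangle lambda a b mA) _.
  rewrite m2E quad_boxE -!setXI qvE; try by apply: measurableI => //; exact: measurable_box.
  rewrite (eq_bigr (fun i => (w i)%:E * u (A i `&` box (a i) (b i)))%E); last first.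
    by move=> i _; exact: point_lawE.
  by rewrite big_split/= prodEFin; congr (_ * _)%E; rewrite big_bool2.
move: C0; rewrite E m2E => /eqP; rewrite mule_eq0 => /orP[|/eqP //].
by rewrite eqe gt_eqF.
Qed.

End disjoint_boxes.

(** * Translated cells *)

Section translated_cells.
Context (R : realType) (d : nat).
Local Notation V := 'rV[R]_d.
Local Notation Q := (bool * bool)%type.

Definition translation_invariant (F : (Q -> V) -> R) : Prop :=
  forall v x, F (fun i => x i + v) = F x.

Definition quad_translate (v : V) (t : quad V) : quad V :=
  mkquad (fun i => quad_coord t i + v).

Lemma measurable_quad_translate v : measurable_fun setT (quad_translate v).
Proof.
have mc i : measurable_fun [set: quad V] (fun t => quad_coord t i + v).
  exact: (measurableT_comp (measurable_translate v) (measurable_quad_coord i)).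
exact: (measurable_mkquad mc).
Qed.

Lemma trivIset_translate (J : finType) (a b : J -> V) (v : V) :
  trivIset setT (fun i => box (a i) (b i)) ->
  trivIset setT (fun i => box (a i + v) (b i + v)).
Proof.
move=> tB i j _ _ [x [xi xj]]; apply: tB => //; exists (x - v).
by split; [move: xi|move: xj]; rewrite -{1}(subrK v x) -[box _ _ _]/(((fun y => y + v) @^-1` box _ _) _)
  preimage_translate_box !addrK.
Qed.

Lemma point_law_translate (lambda : R) (a b v : V) C : measurable C ->
  point_law lambda (a + v) (b + v) C = point_law lambda a b ((fun x => x + v) @^-1` C).
Proof.
move=> mC; rewrite !point_lawE.
have E D : measurable D -> volume (D `&` box (a + v) (b + v)) =
    volume ((fun x => x + v) @^-1` D `&` box a b).
  move=> mD; rewrite -(volume_translate v); last by apply: measurableI => //; exact: measurable_box.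
  by rewrite preimage_setI preimage_translate_box !addrK.
rewrite E//; have -> // : volume (box (a + v) (b + v)) = volume (box a b).
have := E setT measurableT; rewrite setTI => ->.
by congr (volume _); apply/seteqP; split => x //= [].
Qed.

Lemma cell_law_translate (lambda : R) (a b : Q -> V) (v : V) C : measurable C ->
  cell_law lambda (fun i => a i + v) (fun i => b i + v) C =
  cell_law lambda a b (quad_translate v @^-1` C).
Proof.
move=> mC.
pose m2 := measure_function_pushforward__canonical__measure_function_Measure
  (cell_law lambda a b) (measurable_quad_translate v).
have f1 : (cell_law lambda (fun i => a i + v)%R (fun i => b i + v)%R setT < +oo)%E.
  by rewrite -ge0_fin_numE// cell_law_fin.
have f2 : (m2 setT < +oo)%E.
  have : (cell_law lambda a b setT < +oo)%E by rewrite -ge0_fin_numE// cell_law_fin.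
  by [].
apply: (determining_quad f1 f2 _ mC).
move=> _ [_ [A1 mA1 [A2 mA2 ->]] [_ [A3 mA3 [A4 mA4 ->]] ->]].
pose A i := quad_coord ((A1, A2), (A3, A4)) i.
have mA i : measurable (A i) by case: i => -[] [].
have mA' i : measurable ((fun x => x + v) @^-1` A i).
  by rewrite -[X in measurable X]setTI; exact: measurable_translate.
apply: etrans (cell_law_rectangle _ _ _ mA) _.
apply: etrans (esym (cell_law_rectangle _ _ _ mA')).
by apply: eq_bigr => i _; exact: point_law_translate.
Qed.

Lemma cell_integral_translate (lambda : R) (a b : Q -> V) (v : V) C F :
  measurable C -> measurable_statistic F -> (forall x, 0 <= F x) ->
  translation_invariant F ->
  (\int[cell_law lambda (fun i => a i + v)%R (fun i => b i + v)%R]_(t in quad_translate (- v) @^-1` C)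
     (F (quad_coord t))%:E = \int[cell_law lambda a b]_(t in C) (F (quad_coord t))%:E)%E.
Proof.
move=> mC mF F0 tF.
have mC' : measurable (quad_translate (- v) @^-1` C).
  by rewrite -[X in measurable X]setTI; exact: measurable_quad_translate.
have mFq : measurable_fun setT (fun t : quad V => (F (quad_coord t))%:E).
  by apply/measurable_EFinP; exact: measurable_quad_statistic.
pose m2 := measure_function_pushforward__canonical__measure_function_Measure
  (cell_law lambda a b) (measurable_quad_translate v).
transitivity (\int[m2]_(t in quad_translate (- v) @^-1` C) (F (quad_coord t))%:E)%E.
  apply: eq_measure_integral => A mA _.
  exact: cell_law_translate.
have f0 : {in quad_translate (- v) @^-1` C, forall t : quad V, (0 <= (F (quad_coord t))%:E)%E}.
  by move=> t _; rewrite lee_fin.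
apply: etrans (ge0_integral_pushforward (measurable_quad_translate v)
  (cell_law lambda a b) mC' (measurable_funTS mFq) f0) _.
rewrite (_ : quad_translate v @^-1` (quad_translate (- v) @^-1` C) = C).
  by apply: eq_integral => t _ /=; rewrite /quad_translate mkquadK tF.
apply/seteqP; split => t /=; rewrite {1}/quad_translate {1}/quad_translate mkquadK;
  by under eq_fun do rewrite addrK; rewrite quad_coordK.
Qed.

End translated_cells.

Section shifted_cells.
Context (R : realType) (e : nat).
Local Notation V := 'rV[R]_e.+1.
Local Notation Q := (bool * bool)%type.
Variables (a b : Q -> V).

Let width : R := \sum_i (`|a i ord0 ord0| + `|b i ord0 ord0|).

(** All the boxes lie within [width] of zero along the first axis, so that shifting by
multiples of twice this width makes the copies disjoint. *)
Definition cell_shift (k : nat) : V := (k%:R * (2 * width)) *: delta_mx ord0 ord0.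

Let shifted_box k i y : box (a i + cell_shift k) (b i + cell_shift k) y ->
  `|y ord0 ord0 - k%:R * (2 * width)| < width.
Proof.
move=> /(_ ord0); rewrite !mxE !eqxx mulr1 => /andP[ay yb].
have w0 : `|a i ord0 ord0| + `|b i ord0 ord0| <= width.
  by rewrite /width (bigD1 i)//= lerDl sumr_ge0// => j _; rewrite addr_ge0.
have ha := ler_norm (- a i ord0 ord0); have hb := ler_norm (b i ord0 ord0).
rewrite normrN in ha; have na := normr_ge0 (a i ord0 ord0).
have nb := normr_ge0 (b i ord0 ord0).
by rewrite ltr_norml; apply/andP; split; lra.
Qed.

Let shifted_boxes_apart k l i j y : (k < l)%N ->
  box (a i + cell_shift k) (b i + cell_shift k) y ->
  box (a j + cell_shift l) (b j + cell_shift l) y -> False.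
Proof.
move=> kl /shifted_box; rewrite ltr_norml => /andP[h1 h2].
move=> /shifted_box; rewrite ltr_norml => /andP[h3 h4].
have w0 : 0 <= width by apply: sumr_ge0 => m _; rewrite addr_ge0.
have : (k.+1)%:R * (2 * width) <= l%:R * (2 * width).
  by rewrite ler_wpM2r ?mulr_ge0// ler_nat.
by rewrite -natr1; lra.
Qed.

Lemma trivIset_shifted_boxes k l : k <> l ->
  trivIset setT (fun i => box (a i) (b i)) ->
  trivIset setT (fun i => box
    (double_boxes (fun i => a i + cell_shift k) (fun i => a i + cell_shift l) i)
    (double_boxes (fun i => b i + cell_shift k) (fun i => b i + cell_shift l) i)).
Proof.
move=> kl tB [s i] [s' j] _ _ [y []]; rewrite /double_boxes /=.
have same m : box (a i + cell_shift m) (b i + cell_shift m) y ->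
    box (a j + cell_shift m) (b j + cell_shift m) y -> i = j.
  move=> yi yj; have tBm := trivIset_translate (v := cell_shift m) tB.
  exact: (tBm i j I I (ex_intro _ y (conj yi yj))).
have apart m n i' j' : m <> n -> box (a i' + cell_shift m) (b i' + cell_shift m) y ->
    box (a j' + cell_shift n) (b j' + cell_shift n) y -> False.
  move=> /eqP; rewrite neq_ltn => /orP[] lt h1 h2; first exact: (shifted_boxes_apart lt h1 h2).
  exact: (shifted_boxes_apart lt h2 h1).
case: s; case: s' => /= yi yj.
- by rewrite (same l).
- by exfalso; apply: (apart k l _ _ kl yj yi).
- by exfalso; apply: (apart k l _ _ kl yi yj).
- by rewrite (same k).
Qed.

Definition shifted_pattern (C : set (quad V)) (E : seq (Q * Q)) (k : nat) :
    set (spatial_graph R e.+1) :=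
  pattern_event (fun i => a i + cell_shift k) (fun i => b i + cell_shift k)
    [set x | (quad_translate (- cell_shift k) @^-1` C) (mkquad x)] E.

Let measurable_shifted (C : set (quad V)) k : measurable C ->
  measurable (quad_translate (- cell_shift k) @^-1` C).
Proof.
by move=> mC; rewrite -[X in measurable X]setTI; exact: measurable_quad_translate.
Qed.

Lemma measurable_shifted_pattern C E k : measurable C ->
  measurable (shifted_pattern C E k).
Proof.
move=> mC; apply: measurable_pattern_event.
exact: (measurable_config_preimage (@measurable_mkquad R e.+1) (measurable_shifted k mC)).
Qed.

Context (dO : measure_display) (Omega : measurableType dO).
Variables (P : probability Omega R) (lambda : R).
Variables (G : {mfun Omega >-> spatial_graph R e.+1}) (X : nat -> {mfun Omega >-> V}).
Hypotheses (lambda_gt0 : 0 < lambda)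
  (hP : homogeneous_poisson P lambda (fun w => vertices (G w)))
  (hX : enumerates_vertices P G X)
  (tB : trivIset setT (fun i => box (a i) (b i))).
Variables (C : set (quad V)) (E : seq (Q * Q)) (F : (Q -> V) -> R).
Hypotheses (mC : measurable C) (F0 : forall x, 0 <= F x) (mF : measurable_statistic F)
  (tF : translation_invariant F) (hE : edge_law P G X E F)
  (hE2 : edge_law P G X (double_pattern E)
    (fun x => F (fun i => x (false, i)) * F (fun i => x (true, i)))).

Lemma shifted_pattern_frequency k :
  P (G @^-1` shifted_pattern C E k) =
  (\int[cell_law lambda a b]_(t in C) (F (quad_coord t))%:E)%E.
Proof.
rewrite (one_cell_probability lambda_gt0 hP hX F0 mF hE).
- exact: cell_integral_translate.
- exact: trivIset_translate.
- exact: measurable_shifted.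
Qed.

Lemma shifted_pattern_pair_frequency k l : k <> l ->
  P (G @^-1` (shifted_pattern C E k `&` shifted_pattern C E l)) =
  (\int[cell_law lambda a b]_(t in C) (F (quad_coord t))%:E *
   \int[cell_law lambda a b]_(t in C) (F (quad_coord t))%:E)%E.
Proof.
move=> kl.
have hk := cell_integral_translate lambda a b (cell_shift k) mC mF F0 tF.
have hl := cell_integral_translate lambda a b (cell_shift l) mC mF F0 tF.
apply: etrans (two_cells_probability lambda_gt0 hP hX F0 mF hE2
  (trivIset_shifted_boxes kl tB) (measurable_shifted k mC) (measurable_shifted l mC)) _.
exact: (f_equal2 mule hk hl).
Qed.

End shifted_cells.

(** * The two models are mutually singular *)

Section model_statistics.
Context (R : realType) (e : nat).
Local Notation V := 'rV[R]_e.+1.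
Local Notation Q := (bool * bool)%type.
Variables (fin fout g : R -> R).
Hypotheses (mfin : measurable_fun (`[(0 : R), +oo[ : set R) fin)
  (mfout : measurable_fun (`[(0 : R), +oo[ : set R) fout)
  (mg : measurable_fun (`[(0 : R), +oo[ : set R) g)
  (fin0 : forall r, 0 <= r -> 0 <= fin r) (fout0 : forall r, 0 <= r -> 0 <= fout r)
  (g0 : forall r, 0 <= r -> 0 <= g r).
Variable E : seq (Q * Q).

Lemma cell_statistic_ge0 (x : Q -> V) : 0 <= cell_statistic fin fout E x.
Proof.
rewrite mulr_ge0 ?exprn_ge0 ?invr_ge0// sumr_ge0// => z _; apply: prodr_ge0 => p _ /=.
by case: ifP => _; [apply: fin0|apply: fout0]; exact: enorm_ge0.
Qed.

Lemma rcm_statistic_ge0 (x : Q -> V) : 0 <= rcm_statistic g E x.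
Proof. by apply: prodr_ge0 => p _; apply: g0; exact: enorm_ge0. Qed.

Lemma measurable_cell_statistic :
  measurable_statistic (fun x : Q -> V => cell_statistic fin fout E x).
Proof.
move=> dW W Y mY; apply: measurable_funM; first exact: measurable_cst.
apply: measurable_sum => z.
apply: (@measurable_pair_statistic R e.+1 Q E
  (fun p r => if quad_coord z p.1 == quad_coord z p.2 then fin r else fout r)) => // p.
by case: eqP.
Qed.

Lemma measurable_rcm_statistic :
  measurable_statistic (fun x : Q -> V => rcm_statistic g E x).
Proof. exact: (@measurable_pair_statistic R e.+1 Q E (fun _ => g)). Qed.

Lemma translation_invariant_cell_statistic :
  translation_invariant (fun x : Q -> V => cell_statistic fin fout E x).
Proof.
move=> v x; rewrite /cell_statistic /planted_statistic; congr (_ * _).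
apply: eq_bigr => z _; apply: eq_bigr => p _ /=.
by rewrite [- (_ + v)]opprD addrACA subrr addr0.
Qed.

Lemma translation_invariant_rcm_statistic :
  translation_invariant (fun x : Q -> V => rcm_statistic g E x).
Proof.
move=> v x; rewrite /rcm_statistic; apply: eq_bigr => p _.
by rewrite [- (_ + v)]opprD addrACA subrr addr0.
Qed.

End model_statistics.

Definition gap_vectors (R : realType) (e : nat) (fin fout : R -> R) : set 'rV[R]_e.+1 :=
  [set x | x <> 0 /\ fout (enorm x) < fin (enorm x)].

(** The origin is left out so that adjacent points of a 4-cycle are distinct; it has
measure zero, and the other vectors are controlled by their lengths. *)
Lemma volume_gap_gt0 (R : realType) (e : nat) (fin fout : R -> R) :
  measurable_fun (`[(0 : R), +oo[ : set R) fin ->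
  measurable_fun (`[(0 : R), +oo[ : set R) fout ->
  (forall r, 0 <= r -> fout r <= fin r) ->
  (0 < @lebesgue_measure R [set r : R | (0 <= r)%R /\ fin r <> fout r])%E ->
  measurable (@gap_vectors R e fin fout) /\ (0 < volume (@gap_vectors R e fin fout))%E.
Proof.
move=> mfin mfout le hne.
pose D := [set r : R | 0 <= r /\ fout r < fin r].
have DE : [set r : R | (0 <= r)%R /\ fin r <> fout r] = D.
  apply/seteqP; split => r /= [r0 h]; split => //.
    by rewrite lt_neqAle le// andbT; apply/eqP => h'; apply: h.
  by move=> h'; move: h; rewrite h' ltxx.
have mD : measurable D.
  have mdiff : measurable_fun (`[(0 : R), +oo[ : set R) (fun r => fin r - fout r).
    exact: measurable_funB.
  have := mdiff (measurable_itv _) `]0, +oo[%classic (measurable_itv _).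
  congr measurable; apply/seteqP; split => r /=; rewrite !in_itv/= !andbT subr_gt0.
    by [].
  by [].
have D_gt0 : (0 < lebesgue_measure (D `&` `[0%R, +oo[))%E.
  rewrite (_ : D `&` _ = D); first by rewrite -DE.
  by apply/seteqP; split => r /= [] //; rewrite in_itv/= andbT.
pose S := [set x : 'rV[R]_e.+1 | D (enorm x)].
have mS : measurable S.
  rewrite -[X in measurable X]setTI; exact: (measurable_enorm measurableT mD).
have S_gt0 : (0 < volume S)%E by exact: volume_radial_gt0.
have SE : @gap_vectors R e fin fout = S `\` [set 0].
  apply/seteqP; split => x /=; first by move=> [x0 h]; split => //; split => //; exact: enorm_ge0.
  by move=> [[_ h] x0].
rewrite SE; split; first by apply: measurableD => //; exact: measurable_rowvec1.
move: S_gt0; rewrite [X in (0 < X)%E -> _](measureDI (volume (d := e.+1)) mS (measurable_rowvec1 0)).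
rewrite [X in (_ + X)%E](_ : _ = 0%E) ?adde0//.
apply/eqP; rewrite eq_le measure_ge0 andbT -[leRHS](volume1 (0 : 'rV[R]_e.+1)).
apply: le_measure; rewrite ?inE//; last exact: measurable_rowvec1.
by apply: measurableI => //; exact: measurable_rowvec1.
Qed.

(** The pointwise dichotomy covers D by finitely many sets, one for each pattern and each
sign of the difference, and they cannot all be null. *)
Lemma separating_pattern (R : realType) (e : nat) (fin fout g : R -> R)
    (nu : {measure set (quad 'rV[R]_e.+1) -> \bar R}) (D : set (quad 'rV[R]_e.+1)) :
  measurable_fun (`[(0 : R), +oo[ : set R) fin ->
  measurable_fun (`[(0 : R), +oo[ : set R) fout ->
  measurable_fun (`[(0 : R), +oo[ : set R) g ->
  measurable D -> (0 < nu D)%E ->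
  (forall t, D t -> forall p, p \in K22 ->
    fout (enorm (quad_coord t p.1 - quad_coord t p.2)) <
    fin (enorm (quad_coord t p.1 - quad_coord t p.2))) ->
  exists E C, [/\ E \in test_patterns, measurable C, (0 < nu C)%E &
    (forall t, C t -> cell_statistic fin fout E (quad_coord t) < rcm_statistic g E (quad_coord t))
    \/ (forall t, C t -> rcm_statistic g E (quad_coord t) < cell_statistic fin fout E (quad_coord t))].
Proof.
move=> mfin mfout mg mD nuD Dlt; apply: contrapT => H.
move: nuD; rewrite lt0e => /andP[/eqP + _]; apply.
pose f E (t : quad 'rV[R]_e.+1) := cell_statistic fin fout E (quad_coord t).
pose h E (t : quad 'rV[R]_e.+1) := rcm_statistic g E (quad_coord t).
have mf E : measurable_fun setT (f E).
  exact: (measurable_quad_statistic (@measurable_cell_statistic R e _ _ mfin mfout E)).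
have mh E : measurable_fun setT (h E).
  exact: (measurable_quad_statistic (@measurable_rcm_statistic R e _ mg E)).
have mlt f1 f2 : measurable_fun setT f1 -> measurable_fun setT f2 ->
    measurable (D `&` [set t | f1 t < f2 t :> R]).
  move=> m1 m2; apply: measurableI => //.
  rewrite (_ : [set t | _] = (fun t => f2 t - f1 t) @^-1` `]0, +oo[%classic).
    rewrite -[X in measurable X]setTI.
    by have := measurable_funB m2 m1 measurableT (measurable_itv `]0, +oo[); exact.
  by apply/seteqP; split => t /=; rewrite in_itv/= andbT subr_gt0.
pose E n := nth [::] test_patterns n.
pose N n := if (n < size test_patterns)%N then
  (D `&` [set t | f (E n) t < h (E n) t]) `|` (D `&` [set t | h (E n) t < f (E n) t]) else set0.
apply/negligibleP => //; apply: (negligibleS (A := \bigcup_n N n)).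
  move=> t Dt; have [E0 E0in ne] := test_patterns_separate g (Dlt t Dt).
  exists (index E0 test_patterns) => //; rewrite /N index_mem E0in /E nth_index//.
  have := ltgtP (f E0 t) (h E0 t); case=> [lt|gt|eq]; [by left|by right|].
  by exfalso; apply: ne.
apply: negligible_bigcup => n; rewrite /N; case: ifP => ltn; last exact: negligible_set0.
have En : E n \in test_patterns by exact: mem_nth.
have null C : measurable C -> ((0 < nu C)%E -> False) -> nu.-negligible C.
  move=> mC nC; apply/negligibleP => //; apply: contrapT => /eqP C0.
  by apply: nC; rewrite lt0e C0 measure_ge0.
apply: negligibleU; apply: null; try exact: mlt; move=> gt0; apply: H.
  exists (E n), (D `&` [set t | f (E n) t < h (E n) t]); split => //; first exact: mlt.
  by left => t [].
exists (E n), (D `&` [set t | h (E n) t < f (E n) t]); split => //; first exact: mlt.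
by right => t [].
Qed.

Lemma integral_lt_neq d (T : measurableType d) (R : realType)
    (nu : {measure set T -> \bar R}) (C : set T) (f h : T -> R) :
  measurable C -> (0 < nu C)%E -> measurable_fun setT f -> measurable_fun setT h ->
  (forall t, 0 <= f t) -> (forall t, C t -> f t < h t) ->
  (\int[nu]_(t in C) (f t)%:E < +oo)%E ->
  (\int[nu]_(t in C) (f t)%:E)%E <> (\int[nu]_(t in C) (h t)%:E)%E.
Proof.
move=> mC nuC mf mh f0 fh fin eqi.
have mfE : measurable_fun C (fun t => (f t)%:E).
  by apply: measurable_funTS; exact/measurable_EFinP.
have mdE : measurable_fun C (fun t => (h t - f t)%:E).
  by apply: measurable_funTS; apply/measurable_EFinP; exact: measurable_funB.
have d0 t : C t -> (0 <= (h t - f t)%:E)%E.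
  by move=> Ct; rewrite lee_fin subr_ge0 ltW// fh.
have E : (\int[nu]_(t in C) (h t)%:E =
    \int[nu]_(t in C) (f t)%:E + \int[nu]_(t in C) (h t - f t)%:E)%E.
  rewrite -ge0_integralD//; last by move=> t _; rewrite lee_fin.
  by apply: eq_integral => t _; rewrite -EFinD addrC subrK.
have fE : (\int[nu]_(t in C) (f t)%:E)%E \is a fin_num.
  by rewrite ge0_fin_numE//; apply: integral_ge0 => t _; rewrite lee_fin.
have d_eq0 : (\int[nu]_(t in C) (h t - f t)%:E = 0)%E.
  transitivity (\int[nu]_(t in C) (h t)%:E - \int[nu]_(t in C) (f t)%:E)%E.
    by rewrite E addeAC subee// add0e.
  by rewrite -eqi subee.
have := measure0_of_integral0 mC mdE d0 d_eq0.
rewrite (_ : C `&` _ = C); first by move=> C0; move: nuC; rewrite C0 ltxx.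
by apply/seteqP; split => t /=; [case|move=> Ct; split => //; rewrite lte_fin subr_gt0 fh].
Qed.

Theorem theorem3 (R : realType) (lambda : R) (d : nat) (fin fout : R -> R)
    (hlambda : 0 < lambda) (hd : (0 < d)%N)
    (mfin : measurable_fun (`[(0 : R), +oo[ : set R) fin)
    (mfout : measurable_fun (`[(0 : R), +oo[ : set R) fout)
    (hf : forall r : R, 0 <= r -> 1 >= fin r /\ fin r >= fout r /\ fout r >= 0)
    (hint : (0 < \int[vol R d]_(x in [set: 'rV[R]_d])
                   (fin (enorm x) + fout (enorm x))%:E < +oo)%E)
    (hne : (0 < @lebesgue_measure R [set r : R | (0 <= r)%R /\ fin r <> fout r])%E)
    (g : R -> R)
    (mg : measurable_fun (`[(0 : R), +oo[ : set R) g)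
    (hg : forall r : R, 0 <= r -> 0 <= g r <= 1)
    (d1 : measure_display) (Omega1 : measurableType d1)
    (P1 : probability Omega1 R) (G : {mfun Omega1 >-> spatial_graph R d})
    (d2 : measure_display) (Omega2 : measurableType d2)
    (P2 : probability Omega2 R) (H : {mfun Omega2 >-> spatial_graph R d})
    (hG : planted_partition_graph P1 lambda G fin fout)
    (hH : random_connection_model P2 lambda H g) :
  mutually_singular (distribution P1 G) (distribution P2 H).
Proof.
case: d hd hint G H hG hH => [//|e] _ _ G H.
move=> [X1 [Z [[poisson1 enum1] signs indep edges1]]] [X2 [poisson2 enum2 edges2]].
have fout0 r : 0 <= r -> 0 <= fout r by move=> /hf[_ []].
have le r : 0 <= r -> fout r <= fin r by move=> /hf[_ []].
have fin0 r : 0 <= r -> 0 <= fin r by move=> r0; exact: le_trans (fout0 r r0) (le r r0).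
have g0 r : 0 <= r -> 0 <= g r by move=> /hg/andP[].
have [mD D_gt0] := @volume_gap_gt0 R e _ _ mfin mfout le hne.
have [a [b [tB cycles]]] := four_cycle_in_boxes mD D_gt0 (fun x h => proj1 h).
have mcyc := measurable_four_cycle mD.
have law_gt0 := cell_law_neq0 hlambda mcyc cycles.
have gap t : four_cycle (@gap_vectors R e fin fout) t ->
    forall p, p \in K22 -> fout (enorm (quad_coord t p.1 - quad_coord t p.2)) <
      fin (enorm (quad_coord t p.1 - quad_coord t p.2)).
  move=> [[_ h1] [_ h2] [_ h3] [_ h4]] p.
  by rewrite /K22 /= !inE => /or4P[] /eqP ->; rewrite /quad_coord.
have [E [C [Ein mC C_gt0 sep]]] := separating_pattern mfin mfout mg mcyc law_gt0 gap.
have /andP[sE sE2] := test_patterns_simple Ein.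
have law1 : edge_law P1 G X1 E (cell_statistic fin fout E).
  exact: (planted_edge_law quad_coord_surj quad_coord_inj signs indep sE).
have law1' : edge_law P1 G X1 (double_pattern E) (fun x =>
    cell_statistic fin fout E (fun i => x (false, i)) *
    cell_statistic fin fout E (fun i => x (true, i))).
  have <- : planted_statistic double_signs fin fout (double_pattern E) =
      (fun x : bool * (bool * bool) -> 'rV[R]_e.+1 =>
        cell_statistic fin fout E (fun i => x (false, i)) *
        cell_statistic fin fout E (fun i => x (true, i))).
    by apply/funext => x; exact: planted_statistic_double.
  exact: (planted_edge_law double_signs_surj double_signs_inj signs indep sE2).
have law2 : edge_law P2 H X2 E (rcm_statistic g E) by exact: rcm_edge_law.
have law2' : edge_law P2 H X2 (double_pattern E) (fun x =>
    rcm_statistic g E (fun i => x (false, i)) * rcm_statistic g E (fun i => x (true, i))).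
  have <- : rcm_statistic g (double_pattern E) =
      (fun x : bool * (bool * bool) -> 'rV[R]_e.+1 =>
        rcm_statistic g E (fun i => x (false, i)) * rcm_statistic g E (fun i => x (true, i))).
    by apply/funext => x; exact: rcm_statistic_double.
  exact: rcm_edge_law.
pose S k := shifted_pattern a b C E k.
have mS k : measurable (S k) by exact: measurable_shifted_pattern.
pose Fp := (\int[cell_law lambda a b]_(t in C) (cell_statistic fin fout E (quad_coord t))%:E)%E.
pose Fr := (\int[cell_law lambda a b]_(t in C) (rcm_statistic g E (quad_coord t))%:E)%E.
have mfp := @measurable_cell_statistic R e _ _ mfin mfout E.
have mfr := @measurable_rcm_statistic R e _ mg E.
have pS k : distribution P1 G (S k) = Fp.
  exact: (shifted_pattern_frequency hlambda poisson1 enum1 tB mC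
    (cell_statistic_ge0 fin0 fout0 E) mfp (translation_invariant_cell_statistic fin fout E) law1).
have rS k : distribution P2 H (S k) = Fr.
  exact: (shifted_pattern_frequency hlambda poisson2 enum2 tB mC
    (rcm_statistic_ge0 g0 E) mfr (translation_invariant_rcm_statistic g E) law2).
have pSS k l : k <> l -> distribution P1 G (S k `&` S l) = (Fp * Fp)%E.
  exact: (shifted_pattern_pair_frequency hlambda poisson1 enum1 tB mC
    (cell_statistic_ge0 fin0 fout0 E) mfp (translation_invariant_cell_statistic fin fout E) law1').
have rSS k l : k <> l -> distribution P2 H (S k `&` S l) = (Fr * Fr)%E.
  exact: (shifted_pattern_pair_frequency hlambda poisson2 enum2 tB mC
    (rcm_statistic_ge0 g0 E) mfr (translation_invariant_rcm_statistic g E) law2').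
have Fp_fin : Fp \is a fin_num by rewrite -(pS 0%N); exact: fin_num_measure.
have Fr_fin : Fr \is a fin_num by rewrite -(rS 0%N); exact: fin_num_measure.
have FpFr : Fp <> Fr.
  have mp := measurable_quad_statistic mfp; have mr := measurable_quad_statistic mfr.
  case: sep => lt.
    apply: (integral_lt_neq mC C_gt0 mp mr _ lt).
      by move=> t; exact: cell_statistic_ge0.
    by rewrite -ge0_fin_numE ?Fp_fin//; apply: integral_ge0 => t _; rewrite lee_fin cell_statistic_ge0.
  apply/nesym; apply: (integral_lt_neq mC C_gt0 mr mp _ lt).
    by move=> t; exact: rcm_statistic_ge0.
  by rewrite -ge0_fin_numE ?Fr_fin//; apply: integral_ge0 => t _; rewrite lee_fin rcm_statistic_ge0.
apply: (@singular_of_frequencies _ _ _ (distribution P1 G) (distribution P2 H) S (fine Fp) (fine Fr)) => //.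
- by move=> h; apply: FpFr; rewrite -(fineK Fp_fin) -(fineK Fr_fin) h.
- by move=> k; rewrite fineK//; exact: pS.
- by move=> k; rewrite fineK//; exact: rS.
- by move=> k l kl; rewrite EFinM fineK//; exact: pSS.
- by move=> k l kl; rewrite EFinM fineK//; exact: rSS.
Qed.
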